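(* Let $g$ satisfy (G1) and (G2), let $\alpha\in\mathbb{R}\setminus\{0\}$, $\sigma>0$, $c>0$, $K=\alpha^2/(c\sigma^2)$, and let $$V_*(\pi):=\inf_{\tau\in\mathcal{T}}\mathbb{E}_\pi\left[c\tau+g(\Pi_\tau)\right],\qquad \pi\in(0,1).$$ Then $V_*-2K^{-1}\Psi$ defines the convex envelope of $H$ on $(0,1)$ (i.e. the largest convex function on $(0,1)$ lying below $H$), and for $\pi\in(0,1)$ it satisfies $$V_*(\pi)-2K^{-1}\Psi(\pi)=\inf_{\tau\in\mathcal{T}}\mathbb{E}_\pi\left[H(\Pi_\tau)\right].$$
   Context: Probabilistic setting: on a stochastic basis $(\Omega,\mathcal{F},\mathbb{F},\mathbb{P})$ there are a Brownian motion $W$ and an independent random variable $\theta\in\{0,1\}$ with $\mathbb{P}(\theta=1)=\pi\in(0,1)$; $\mathbb{E}_\pi$ denotes expectation under this prior. The observed signal is $X_t=\alpha\theta t+\sigma W_t$, with filtration $\mathbb{F}^X=(\mathcal{F}^X_t)_{t\ge0}$ generated by $X$. The posterior process is $\Pi_t:=\mathbb{P}(\theta=1\mid\mathcal{F}^X_t)$, which satisfies $d\Pi_t=\frac{\alpha}{\sigma}\Pi_t(1-\Pi_t)\,d\overline{W}_t$, $\Pi_0=\pi$, where $\overline{W}_t:=\sigma^{-1}\left(X_t-\alpha\int_0^t\Pi_s\,ds\right)$ is an $\mathbb{F}^X$-Brownian motion. $\mathcal{T}$ is the set of a.s. finite stopping times of the filtration $\mathbb{F}^\Pi$ generated by $\Pi$.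 For $f\in C^2(0,1)$, $(\mathcal{A}f)(\pi):=\tfrac12\pi^2(1-\pi)^2f''(\pi)$. The function $g:[0,1]\to\mathbb{R}$ satisfies: (G1) $g\in C^2(0,1)$ is concave and $g(0)=g(1)=0$; (G2) there exists $\pi_0\in(0,1)$ such that $\mathcal{A}g$ is strictly decreasing on $(0,\pi_0)$ and strictly increasing on $(\pi_0,1)$. For $\pi\in(0,1)$, $\Psi(\pi):=(1-2\pi)\log\left(\frac{\pi}{1-\pi}\right)$ and $H(\pi):=g(\pi)-2K^{-1}\Psi(\pi)$. *)

(* Defs.v *)
From HB Require Import structures.
From mathcomp Require Import all_boot all_order all_algebra.
From mathcomp Require Import all_classical all_reals all_analysis.

Set Implicit Arguments.
Unset Strict Implicit.
Unset Printing Implicit Defensive.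

Import Order.TTheory GRing.Theory Num.Theory.
Import numFieldNormedType.Exports.

Local Open Scope classical_set_scope.
Local Open Scope ring_scope.

(* Processes are indexed by the reals, but only their values at times t >= 0
   are ever constrained or used. *)

Section processes.
Context {R : realType} {d : measure_display} {T : measurableType d}.
Implicit Types (P : probability T R) (Z W : R -> T -> R) (F : R -> set (set T)).

Definition sigma_process Z (I : set R) : set (set T) :=
  <<s \bigcup_(s in I) preimage_set_system setT (Z s) measurable >>.

Definition natural_filtration Z (t : R) : set (set T) :=
  sigma_process Z `[0, t].

Definition filtration F : Prop :=
  [/\ forall t : R, 0 <= t -> sigma_algebra setT (F t),
      forall t : R, 0 <= t -> F t `<=` measurable &
      forall s t : R, 0 <= s -> s <= t -> F s `<=` F t].

Definition adapted F Z : Prop :=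
  forall t : R, 0 <= t -> preimage_set_system setT (Z t) measurable `<=` F t.

Definition continuous_paths Z : Prop :=
  forall w, {within `[0, +oo[, continuous (fun t => Z t w)}.

Definition independent P (G1 G2 : set (set T)) : Prop :=
  forall A B, G1 A -> G2 B -> P (A `&` B) = (P A * P B)%E.

(* The second parameter of normal_prob is the standard deviation. *)
Definition brownian_motion P F W : Prop :=
  [/\ adapted F W,
      continuous_paths W,
      forall w, W 0 w = 0,
      forall s t : R, 0 <= s -> s < t ->
        independent P (F s)
          (preimage_set_system setT (fun w => W t w - W s w) measurable) &
      forall s t : R, 0 <= s -> s < t -> forall B : set R, measurable B ->
        P ((fun w => W t w - W s w) @^-1` B)
          = normal_prob 0 (Num.sqrt (t - s)) B].

Definition cond_prob_version P (G : set (set T)) (A : set T) (Y : T -> R) :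
    Prop :=
  [/\ preimage_set_system setT Y measurable `<=` G,
      P.-integrable setT (EFin \o Y) &
      forall B, G B -> (\int[P]_(w in B) (Y w)%:E)%E = P (B `&` A)].

Definition stopping_time F (tau : T -> \bar R) : Prop :=
  (forall w, (0 <= tau w)%E) /\
  (forall t : R, 0 <= t -> F t [set w | (tau w <= t%:E)%E]).

Definition finite_stopping_times P F : set (T -> \bar R) :=
  [set tau | stopping_time F tau /\ {ae P, forall w, (tau w < +oo)%E}].

(* On the event tau = +oo this is the junk value Z 0; it is only used for
   almost surely finite tau. *)
Definition stopped Z (tau : T -> \bar R) (w : T) : R := Z (fine (tau w)) w.

Definition signal (alpha sigma : R) (theta : T -> R) W (t : R) (w : T) : R :=
  alpha * theta w * t + sigma * W t w.

(* The conditional probabilities P(theta = 1 | F^X_t) are each determined only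
   almost surely; the posterior process is a [0, 1]-valued version of them
   with continuous paths. *)
Definition posterior_process P (theta : T -> R) (X : R -> T -> R) Z : Prop :=
  [/\ forall t : R, 0 <= t ->
        cond_prob_version P (natural_filtration X t) (theta @^-1` [set 1]) (Z t),
      forall t w, 0 <= t -> 0 <= Z t w <= 1 &
      continuous_paths Z].

Record signal_model (alpha sigma p : R) P F W (theta : T -> R) Z : Prop :=
  SignalModel {
    model_filtration : filtration F;
    model_brownian : brownian_motion P F W;
    model_theta_measurable : measurable_fun setT theta;
    model_theta01 : forall w, theta w = 0 \/ theta w = 1;
    model_prior : P (theta @^-1` [set 1]) = p%:E;
    model_independent :
      independent P (preimage_set_system setT theta measurable)
        (sigma_process W `[0, +oo[);
    model_posterior : posterior_process P theta (signal alpha sigma theta W) Z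
  }.

End processes.

Section cost.
Context {R : realType}.
Implicit Types (f g : R -> R) (D : set R).

Definition generatorA f (x : R) : R :=
  2^-1 * x ^+ 2 * (1 - x) ^+ 2 * (f^`(2))%classic x.

Definition C2_open01 f : Prop :=
  forall x : R, 0 < x < 1 ->
    [/\ derivable f x 1, derivable (f^`())%classic x 1 & {for x, continuous (f^`(2))%classic}].

Definition convex_on D f : Prop := convex_function (D : set R^o) f.

Definition concave_on D f : Prop := convex_on D (fun x => - f x).

(* g and all functions on [0, 1] or (0, 1) are represented by total functions
   whose values elsewhere are irrelevant. *)
Definition G1 g : Prop :=
  [/\ C2_open01 g, concave_on `[0, 1] g, g 0 = 0 & g 1 = 0].

Definition G2 g : Prop :=
  exists2 p0 : R, 0 < p0 < 1 &
    (forall x y : R, 0 < x -> x < y -> y < p0 -> generatorA g y < generatorA g x) /\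
    (forall x y : R, p0 < x -> x < y -> y < 1 -> generatorA g x < generatorA g y).

Definition Psi (x : R) : R := (1 - 2 * x) * ln (x / (1 - x)).

Definition Kconst (alpha sigma c : R) : R := alpha ^+ 2 / (c * sigma ^+ 2).

Definition Hfun (K : R) g (x : R) : R := g x - 2 * K^-1 * Psi x.

Definition convex_envelope D (h f : R -> R) : Prop :=
  [/\ convex_on D f,
      forall x : R, D x -> f x <= h x &
      forall k : R -> R, convex_on D k -> (forall x : R, D x -> k x <= h x) ->
        forall x : R, D x -> k x <= f x].

End cost.

Section value.
Context {R : realType} {d : measure_display} {T : measurableType d}.
Local Open Scope ereal_scope.

Definition Vstar (P : probability T R) (c : R) (g : R -> R) (Z : R -> T -> R) :
    \bar R :=
  ereal_inf [set \int[P]_w (c%:E * tau w + (g (stopped Z tau w))%:E)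
            | tau in finite_stopping_times P (natural_filtration Z)].

Definition pure_stopping_value (P : probability T R) (h : R -> R)
    (Z : R -> T -> R) : \bar R :=
  ereal_inf [set \int[P]_w (h (stopped Z tau w))%:E
            | tau in finite_stopping_times P (natural_filtration Z)].

End value.

(* Main.v *)
(* Write [mu = alpha / sigma], let [L_t = ln (p / (1 - p)) + (mu / sigma) X_t -
   mu^2 t / 2] and let [S] be the logistic function.  A Cameron-Martin argument
   on cylinder events, followed by pi-lambda, gives Bayes' formula
   [Pi_t = S (L_t)], first for each [t] and then, by continuity, almost surely
   for all [t].

   Ito's formula is replaced by a family of martingales.  For [0 <= a <= 1],
     [exp (mu^2 a (1 - a) t / 2) Pi_t^a (1 - Pi_t)^(1 - a)]
   is a martingale, bounded on bounded time intervals, so optional stopping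
   follows from discretisation and dominated convergence.  Taking [a = 1] gives
   [E Pi_tau = p]; adding the martingales for [a = e] and [a = 1 - e] and
   differentiating at [e = 0] gives [E (Psi (Pi_tau) + mu^2 tau / 2) = Psi p]
   when [tau] and [L_tau] are bounded.  Since [2 K^-1 mu^2 / 2 = c], the running
   cost is thereby turned into [2 K^-1 (Psi p - Psi (Pi_tau))].

   As [- Psi >= 0], Fatou's lemma yields
   [E (c tau + g (Pi_tau)) >= 2 K^-1 Psi p + E H (Pi_tau)] for every [tau], with
   equality for exit times of [Pi] from an interval [(x, y)], whose reward
   [E H (Pi_tau)] is the value at [p] of the chord of [H] over [[x, y]].  The
   infimum of these chords has an affine support below [H] at each point; the
   relation [E Pi_tau = p] turns that support into a lower bound for both
   stopping problems, and it also makes the infimum convex. *)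
Require Import Defs.
From HB Require Import structures.
From mathcomp Require Import all_boot all_order all_algebra.
From mathcomp Require Import all_classical all_reals all_analysis.
From mathcomp Require Import measurable_realfun ring lra.

Set Implicit Arguments.
Unset Strict Implicit.
Unset Printing Implicit Defensive.

Import Order.TTheory GRing.Theory Num.Theory.
Import numFieldNormedType.Exports.

Local Open Scope classical_set_scope.
Local Open Scope ring_scope.

(** * Densities and the Gaussian shift *)

(** The family of martingales works because of a change of measure: on events of the signal up to
    [t], the part of [P] on [theta = 1] is the part on [theta = 0] weighted by [expR L_t], so [P]
    becomes the weight [1 + expR L_t] on [theta = 0]. This weight cancels the denominator of the
    logistic function and leaves [expR (a L_t)], whose mean is a Gaussian moment. The posterior
    equals [S (L_t)] only almost surely, and its filtration is not completed. Exit times are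
    therefore built from the given paths and shown to be stopping times of the raw filtration;
    conversely, stopping times of the posterior are stopping times of [L], so the martingales apply
    to them. [Psi] tends to minus infinity at 0 and 1, so [E Psi (Pi_tau)] and [E tau] may be
    infinite for general [tau]. Costs are therefore compared through nonnegative integrands, which
    [H >= 0] on [[0, 1]] permits. Each prior has its own probability space, so convexity in the
    prior comes from the geometry of chords and not from conditioning at a later time. *)

Section integral_density.
Local Open Scope ereal_scope.
Context d (T : measurableType d) (R : realType).
Variables (mu nu : {measure set T -> \bar R}) (h : T -> R).
Hypotheses (mh : measurable_fun [set: T] h) (h0 : forall x, (0 <= h x)%R).
Hypothesis nuE : forall A, measurable A -> nu A = \int[mu]_(x in A) (h x)%:E.

Import HBNNSimple.

(** [nuE] settles indicators; simple functions increasing to [f] carry the identity over by monotone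
    convergence on both sides. *)
Lemma ge0_integral_density (f : T -> \bar R) :
  measurable_fun setT f -> (forall x, 0 <= f x) ->
  \int[nu]_x f x = \int[mu]_x (f x * (h x)%:E).
Proof.
move=> mf f0; pose k := nnsfun_approx measurableT mf.
have kf x : (k n x)%:E @[n --> \oo] --> f x by exact: cvg_nnsfun_approx.
have mhE : measurable_fun setT (EFin \o h) by exact/measurable_EFinP.
have -> : \int[nu]_x f x = limn (fun n => \int[nu]_x (k n x)%:E).
  rewrite -monotone_convergence//.
  - by apply: eq_integral => x _; apply/esym/cvg_lim.
  - by move=> n; exact/measurable_EFinP.
  - by move=> n x _; rewrite lee_fin.
  - by move=> x _ a b ab; rewrite lee_fin; exact/lefP/nd_nnsfun_approx.
have -> : \int[mu]_x (f x * (h x)%:E) =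
    limn (fun n => \int[mu]_x ((k n x)%:E * (h x)%:E)).
  rewrite -monotone_convergence//.
  - by apply: eq_integral => x _; apply/esym/cvg_lim => //; exact: cvgeZr.
  - by move=> n; apply: emeasurable_funM => //; exact/measurable_EFinP.
  - by move=> n x _; rewrite mule_ge0// lee_fin.
  - move=> x _ a b ab; rewrite lee_wpmul2r ?lee_fin//.
    exact/lefP/nd_nnsfun_approx.
apply: congr_lim; apply/funext => n /=.
have indich r : measurable_fun setT (fun x => (r * \1_(k n @^-1` [set r]) x)%:E).
  by apply/measurable_EFinP; exact: measurable_funM.
transitivity (\int[nu]_x
   (\sum_(y \in range (k n)) (y * \1_(k n @^-1` [set y]) x)%:E)).
  by apply: eq_integral => t tE; rewrite /= fimfunE -fsumEFin.
rewrite ge0_integral_fsum//; last by move=> m y Ey; exact: nnfun_muleindic_ge0.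
transitivity (\int[mu]_x (\sum_(y \in range (k n))
    (y * \1_(k n @^-1` [set y]) x)%:E * (h x)%:E)); last first.
  apply: eq_integral => x _.
  rewrite -ge0_mule_fsuml => [|y]; last exact: nnfun_muleindic_ge0.
  by rewrite fsumEFin // -(fimfunE _ x).
rewrite ge0_integral_fsum//; last 2 first.
  - by move=> y; apply: emeasurable_funM.
  - move=> m y Ey; apply: mule_ge0; last by rewrite lee_fin.
    exact: nnfun_muleindic_ge0.
apply: eq_fsbigr => r rhn.
under eq_integral do rewrite EFinM.
rewrite integralZl_indic_nnsfun => //.
under [RHS]eq_integral do rewrite EFinM -muleA.
have r0 : (0 <= r)%R by move: rhn; rewrite inE => -[x _ <-].
rewrite ge0_integralZl//.
- under [X in _ = _ * X]eq_integral do rewrite muleC.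
  rewrite [X in _ = _ * X](eq_integral ((EFin \o h) \_ (k n @^-1` [set r]))); last first.
    by move=> x xE; rewrite epatch_indic.
  by rewrite -integral_mkcond integral_indic// setIT nuE.
- by apply: emeasurable_funM => //; exact/measurable_EFinP.
- by move=> x _; rewrite mule_ge0 ?lee_fin.
Qed.

End integral_density.

Section normal_shift.
Local Open Scope ereal_scope.
Context (R : realType).

(** Lebesgue measure is determined by its values on half-open intervals, and a translation preserves
    their lengths. *)
Lemma integral_lebesgue_shift (m : R) (f : R -> \bar R) :
  measurable_fun [set: R] f -> (forall x, 0 <= f x) ->
  \int[lebesgue_measure]_x f (x + m)%R = \int[lebesgue_measure]_x f x.
Proof.
move=> mf f0.
have ms : measurable_fun [set: R] (fun x : R => x + m)%R by exact: measurable_funD.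
pose phi : R -> measurableTypeR R := (fun x : R => x + m)%R.
rewrite [RHS](@eq_measure_integral _ _ _ _ (pushforward lebesgue_measure phi)).
  by rewrite ge0_integral_pushforward//= preimage_setT.
move=> A mA _; apply: (@lebesgue_measure_unique R) => //= _ [[a b]] _ <-.
rewrite /pushforward.
rewrite (_ : phi @^-1` _ = `](a - m)%R, (b - m)%R]%classic).
  rewrite !lebesgue_measure_itv/= !lte_fin ltrD2r -!EFinB.
  by rewrite (_ : (b - m - (a - m) = b - a)%R)//; ring.
by apply/seteqP; split => x /=; rewrite !in_itv/= lerBrDr ltrBlDr.
Qed.

Lemma integral_normal_probE (m s : R) (f : R -> \bar R) :
  measurable_fun [set: R] f -> (forall x, 0 <= f x) ->
  \int[normal_prob m s]_x f x =
  \int[lebesgue_measure]_x (f x * (normal_pdf m s x)%:E).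
Proof.
move=> mf f0; apply: ge0_integral_density => //.
  exact: measurable_normal_pdf.
by move=> x; exact: normal_pdf_ge0.
Qed.

(** One-dimensional Cameron-Martin formula: a translation moves the shift from [f] to the Gaussian
    density, and the exponential is the quotient of the shifted and the centred density. *)
Lemma integral_normal_shift (m s : R) (f : R -> \bar R) : s != 0%R ->
  measurable_fun [set: R] f -> (forall x, 0 <= f x) ->
  \int[normal_prob 0 s]_x f (x + m)%R =
  \int[normal_prob 0 s]_x (f x * (expR (m * x / s ^+ 2 - m ^+ 2 / (2 * s ^+ 2)))%:E).
Proof.
move=> s0 mf f0.
have mp := measurable_normal_pdf (0 : R) s.
have ms a : measurable_fun [set: R] (fun x : R => x + a)%R by exact: measurable_funD.
have mE : measurable_fun [set: R]
    (fun x => expR (m * x / s ^+ 2 - m ^+ 2 / (2 * s ^+ 2)))%R.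
  apply: measurableT_comp => //; apply: measurable_funB => //.
  by apply: measurable_funM => //; apply: measurable_funM.
rewrite integral_normal_probE//; last exact: measurableT_comp.
rewrite integral_normal_probE//; last 2 first.
- by apply: emeasurable_funM => //; exact/measurable_EFinP.
- by move=> x; rewrite mule_ge0// lee_fin expR_ge0.
rewrite -(@integral_lebesgue_shift (- m)); last 2 first.
- by apply: emeasurable_funM; [exact: measurableT_comp|exact/measurable_EFinP].
- by move=> x; rewrite mule_ge0// lee_fin normal_pdf_ge0.
apply: eq_integral => x _; rewrite -addrA addNr addr0 -muleA; congr (_ * _).
rewrite -EFinM; congr EFin.
rewrite normal_pdfE// mulrCA; congr (_ * _)%R; rewrite /normal_fun -expRD.
congr expR; rewrite !subr0 -mulr_natr; field.
by rewrite s0.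
Qed.

(** Shifting the constant 1 by [l * s ^+ 2] says that the tilted density has mass 1; the normalising
    constant of the tilt is the moment generating function. *)
Lemma normal_prob_mgf (l s : R) : s != 0%R ->
  \int[normal_prob 0 s]_x (expR (l * x))%:E = (expR (l ^+ 2 * s ^+ 2 / 2))%:E.
Proof.
move=> s0.
have := @integral_normal_shift (l * s ^+ 2)%R s (cst 1) s0 (measurable_cst _)
  (fun=> lee01).
rewrite integral_cst//= mul1e [X in X = _ -> _]probability_setT => h.
transitivity ((expR (l ^+ 2 * s ^+ 2 / 2))%:E * \int[normal_prob 0 s]_x
  (1 * (expR (l * s ^+ 2 * x / s ^+ 2 - (l * s ^+ 2) ^+ 2 / (2 * s ^+ 2)))%:E)).
  rewrite -ge0_integralZl//.
    apply: eq_integral => x _; rewrite mul1e -EFinM -expRD; congr (expR _)%:E.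
    by field.
  - apply: emeasurable_funM => //; apply/measurable_EFinP.
    apply: measurableT_comp => //; apply: measurable_funB => //.
    by apply: measurable_funM => //; apply: measurable_funM.
rewrite [X in _ * X](_ : _ = 1); first by rewrite mule1.
exact: (esym h).
Qed.

End normal_shift.

Section integral_restriction.
Local Open Scope ereal_scope.
Context d (T : measurableType d) (R : realType).

Lemma ge0_integral_mrestr (mu : {measure set T -> \bar R}) (D : set T)
    (mD : measurable D) (f : T -> \bar R) :
  measurable_fun [set: T] f -> (forall x, 0 <= f x) ->
  \int[mrestr mu mD]_x f x = \int[mu]_(x in D) f x.
Proof.
move=> mf f0; rewrite (@ge0_integral_density _ _ _ mu (mrestr mu mD) (\1_D))//.
- rewrite [RHS]integral_mkcond; apply: eq_integral => x _.
  by rewrite epatch_indic.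
- by move=> A mA; rewrite integral_indic// setIC.
Qed.

End integral_restriction.

Section restricted_law.
Local Open Scope ereal_scope.
Context d (T : measurableType d) (R : realType) (P : probability T R).
Variables (D : set T) (mD : measurable D) (z : T -> R).

(* The measurability proof is an argument so that the measure structure below
   can be inferred. *)
Definition restricted_law (mz : measurable_fun [set: T] z) :
    set (measurableTypeR R) -> \bar R :=
  pushforward (mrestr P mD) (z : T -> measurableTypeR R).

Hypothesis mz : measurable_fun [set: T] z.

Let mz' : measurable_fun [set: T] (z : T -> measurableTypeR R) := mz.

Let m : {measure set (measurableTypeR R) -> \bar R} :=
  measure_function_pushforward__canonical__measure_function_Measure
    (mrestr P mD) mz'.

HB.instance Definition _ := isMeasure.Build _ _ _ (restricted_law mz)
  (measure0 m) (measure_ge0 m) (@measure_semi_sigma_additive _ _ _ m).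

Let restricted_law_fin : fin_num_fun (restricted_law mz).
Proof.
move=> A mA; rewrite /restricted_law /pushforward /mrestr fin_num_measure//.
by apply: measurableI => //; rewrite -[X in measurable X]setTI; exact: mz.
Qed.

HB.instance Definition _ :=
  Measure_isFinite.Build _ _ _ (restricted_law mz) restricted_law_fin.

Lemma ge0_integral_restricted_law (B : set R) (f : R -> \bar R) :
  measurable B -> measurable_fun [set: R] f -> (forall x, 0 <= f x) ->
  \int[restricted_law mz]_(x in B) f x = \int[P]_(w in D `&` z @^-1` B) f (z w).
Proof.
move=> mB mf f0; have mzB : measurable (z @^-1` B).
  by rewrite -[X in measurable X]setTI; exact: mz.
rewrite ge0_integral_pushforward//; last exact: (measurable_funS measurableT).
rewrite integral_mkcond ge0_integral_mrestr; first by rewrite -integral_mkcondr.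
- by apply/(measurable_restrictT _ mzB); apply: measurable_funTS; exact: measurableT_comp.
- by move=> w; rewrite patchE; case: ifPn => //= _; exact: f0.
Qed.

End restricted_law.

Section independent_integral.
Local Open Scope ereal_scope.
Context d (T : measurableType d) (R : realType) (P : probability T R).
Variables (D : set T) (mD : measurable D) (z e : T -> R).
Hypotheses (mz : measurable_fun [set: T] z) (me : measurable_fun [set: T] e).
Variable N : probability (measurableTypeR R) R.
Hypothesis indep : forall A B : set R, measurable A -> measurable B ->
  P (D `&` (z @^-1` A `&` e @^-1` B)) = P (D `&` z @^-1` A) * N B.

(** By [indep], the law of [(z, e)] on [D] agrees on rectangles with the product of the law of [z]
    on [D] and [N], hence everywhere; Tonelli's theorem then integrates out [e]. The event [D]
    carries the part of the past that [z] does not describe. *)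
Lemma integral_independent (u : R * R -> \bar R) :
  measurable_fun [set: R * R] u -> (forall x, 0 <= u x) ->
  \int[P]_(w in D) u (z w, e w) = \int[P]_(w in D) \int[N]_y u (z w, y).
Proof.
move=> mu u0.
have mze : measurable_fun [set: T] (fun w => (z w, e w)) by exact/measurable_fun_pair.
have mF := @measurable_fun_fubini_tonelli_F _ _ _ (measurableTypeR R) _ N u mu u0.
rewrite -(ge0_integral_mrestr _ mD); [|exact: measurableT_comp|by []].
rewrite -(ge0_integral_mrestr _ mD); last 2 first.
- exact: (measurableT_comp mF).
- by move=> w; exact: integral_ge0.
pose ze : T -> measurableTypeR R * measurableTypeR R := fun w => (z w, e w).
have mze' : measurable_fun [set: T] ze := mze.
transitivity (\int[pushforward (mrestr P mD) ze]_x u x).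
  by rewrite ge0_integral_pushforward.
transitivity (\int[(restricted_law P mD mz)]_x fubini_F N u x); last first.
  rewrite ge0_integral_pushforward//.
  by move=> x _; exact: integral_ge0.
rewrite -(@fubini_tonelli1 _ _ _ _ _ (restricted_law P mD mz) N u mu u0).
pose nu : {measure set (measurableTypeR R * measurableTypeR R) -> \bar R} :=
  measure_function_pushforward__canonical__measure_function_Measure
    (mrestr P mD) mze'.
apply: (@eq_measure_integral _ _ _ _ _ nu) => A mA _.
apply/esym/product_measure_unique => // B C mB mC.
rewrite /restricted_law /nu /= /pushforward /mrestr setIC indep//.
by rewrite setIC.
Qed.

End independent_integral.

Section density_measure.
Local Open Scope ereal_scope.
Context d (T : measurableType d) (R : realType) (mu : {measure set T -> \bar R}).
Variable h : T -> R.

(** The proofs [mh] and [h0] are arguments so that the measure structure declared below can be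
    inferred. *)
Definition density_measure (mh : measurable_fun [set: T] h)
    (h0 : forall x, (0 <= h x)%R) (A : set T) : \bar R :=
  \int[mu]_(x in A) (h x)%:E.

Hypotheses (mh : measurable_fun [set: T] h) (h0 : forall x, (0 <= h x)%R).

Let density_measure0 : density_measure mh h0 set0 = 0.
Proof. by rewrite /density_measure integral_set0. Qed.

Let density_measure_ge0 A : 0 <= density_measure mh h0 A.
Proof. by apply: integral_ge0 => x _; rewrite lee_fin. Qed.

Let density_measure_sigma_additive : semi_sigma_additive (density_measure mh h0).
Proof.
move=> A mA tA mUA; rewrite /density_measure ge0_integral_bigcup//=; last 2 first.
- by apply/measurable_funTS/measurable_EFinP.
- by move=> x _; rewrite lee_fin.
apply: is_cvg_ereal_nneg_natsum_cond => n _ _.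
by apply: integral_ge0 => x _; rewrite lee_fin.
Qed.

HB.instance Definition _ := isMeasure.Build _ _ _ (density_measure mh h0)
  density_measure0 density_measure_ge0 density_measure_sigma_additive.

End density_measure.

(** * Filtrations *)

Section sigma_process_theory.
Context {R : realType} {d : measure_display} {T : measurableType d}.
Implicit Types (Z : R -> T -> R) (I : set R) (A B : set T).

Definition process_events Z I : set (set T) :=
  \bigcup_(s in I) preimage_set_system setT (Z s) measurable.

Lemma sigma_process_preimage Z I s (B : set R) : I s -> measurable B ->
  sigma_process Z I (Z s @^-1` B).
Proof.
move=> Is mB; apply: sub_sigma_algebra; exists s => //.
by exists B => //; rewrite setTI.
Qed.

Lemma sigma_process_measurable_fun Z I s : I s ->
  @measurable_fun _ _ (g_sigma_algebraType (process_events Z I)) R setT (Z s).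
Proof. by move=> Is _ B mB; rewrite setTI; exact: sigma_process_preimage. Qed.

Lemma sigma_process_min Z I (S : set (set T)) : sigma_algebra setT S ->
  (forall s (B : set R), I s -> measurable B -> S (Z s @^-1` B)) ->
  sigma_process Z I `<=` S.
Proof.
move=> sS ZS; apply: smallest_sub => // _ [s Is] [B mB <-].
by rewrite setTI; exact: ZS.
Qed.

Lemma sigma_process_le Z I J : I `<=` J -> sigma_process Z I `<=` sigma_process Z J.
Proof.
move=> IJ; apply: sigma_process_min; first exact: smallest_sigma_algebra.
by move=> s B /IJ; exact: sigma_process_preimage.
Qed.

Lemma sigma_processI Z I A B :
  sigma_process Z I A -> sigma_process Z I B -> sigma_process Z I (A `&` B).
Proof. exact: (@measurableI _ (g_sigma_algebraType (process_events Z I))). Qed.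

Lemma sigma_processC Z I A : sigma_process Z I A -> sigma_process Z I (~` A).
Proof. exact: (@measurableC _ (g_sigma_algebraType (process_events Z I))). Qed.

Lemma sigma_processT Z I : sigma_process Z I setT.
Proof. exact: (@measurableT _ (g_sigma_algebraType (process_events Z I))). Qed.

Lemma sigma_process_bigcup Z I (F : (set T)^nat) :
  (forall n, sigma_process Z I (F n)) -> sigma_process Z I (\bigcup_n F n).
Proof.
exact: (@bigcupT_measurable _ (g_sigma_algebraType (process_events Z I))).
Qed.

Lemma natural_filtration_le Z (s t : R) : s <= t ->
  natural_filtration Z s `<=` natural_filtration Z t.
Proof.
move=> st; apply: sigma_process_le => r /=; rewrite !in_itv/= => /andP[-> rs].
exact: le_trans st.
Qed.

Lemma natural_filtration_measurable Z (t : R) :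
  (forall s, 0 <= s -> measurable_fun [set: T] (Z s)) ->
  natural_filtration Z t `<=` measurable.
Proof.
move=> mZ; apply: sigma_process_min; first exact: sigma_algebra_measurable.
move=> s B /=; rewrite in_itv/= => /andP[s0 _] mB.
by rewrite -[X in measurable X]setTI; exact: mZ.
Qed.

End sigma_process_theory.

(** * The log-odds process and Bayes' formula *)

Section likelihood.
Local Open Scope ereal_scope.
Context {R : realType} {d : measure_display} {T : measurableType d}.
Variables (P : probability T R) (F : R -> set (set T)) (W : R -> T -> R).
Variables (theta : T -> R) (l m : R).
Hypotheses (hF : filtration F) (hW : brownian_motion P F W).
Hypothesis mtheta : measurable_fun [set: T] theta.
Hypothesis indep_theta :
  independent P (preimage_set_system setT theta measurable)
    (sigma_process W `[0%R, +oo[).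

(** With [m = alpha / sigma] the inner bracket is [X_t / sigma], and [l] is the prior log-odds. *)
Definition log_odds (t : R) (w : T) : R :=
  l + m * (m * theta w * t + W t w) - m ^+ 2 / 2 * t.

Let phi := log_odds.
Let D (i : R) : set T := theta @^-1` [set i].

Lemma measurable_brownian t : (0 <= t)%R -> measurable_fun [set: T] (W t).
Proof.
move=> t0; case: hF => _ Fm _; case: hW => adW _ _ _ _ => _ B mB.
by apply: (Fm t) => //; apply: (adW t) => //; exists B.
Qed.

Lemma measurable_log_odds t : (0 <= t)%R -> measurable_fun [set: T] (phi t).
Proof.
move=> t0; apply: measurable_funB => //; apply: measurable_funD => //.
apply: measurable_funM => //; apply: measurable_funD.
  by apply: measurable_funM => //; exact: measurable_funM.
exact: measurable_brownian.
Qed.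

Lemma measurable_theta_event i : measurable (D i).
Proof. by rewrite -[X in measurable X]setTI; exact: mtheta. Qed.

Lemma natural_filtration_brownian s : (0 <= s)%R -> natural_filtration W s `<=` F s.
Proof.
case: hF => sF Fm Fle; case: hW => adW _ _ _ _ s0.
apply: sigma_process_min; first exact: sF.
move=> r B /=; rewrite in_itv/= => /andP[r0 rs] mB.
by apply: (Fle r) => //; apply: (adW r) => //; exists B => //; rewrite setTI.
Qed.

(* Given [theta = i], the signal is an affine image of [W]; this transfers the
   independence of [theta] and [W] to events of the signal. *)
Lemma log_odds_trace s i A : natural_filtration phi s A ->
  exists2 C, natural_filtration W s C & A `&` D i = C `&` D i.
Proof.
apply: (sigma_process_min (S := [set A | exists2 C, natural_filtration W s C &
  A `&` D i = C `&` D i])) => [|r B rs mB]; last first.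
  pose f (x : R) : R := (l + m * (m * i * r + x) - m ^+ 2 / 2 * r)%R.
  exists (W r @^-1` (f @^-1` B)).
    apply: sigma_process_preimage => //; rewrite -[X in measurable X]setTI.
    have : measurable_fun [set: R] f; last by apply.
    apply: measurable_funB => //; apply: measurable_funD => //.
    by apply: measurable_funM => //; exact: measurable_funD.
  by apply/seteqP; split => w [/= Bw Dw]; split => //; move: Bw;
    rewrite /phi /log_odds /f Dw.
split.
- by exists set0 => //; exact: sigma_algebra0.
- move=> X [C WC XC]; exists (~` C); first exact: sigma_processC.
  rewrite setTD; apply/seteqP; split => w [/= nX Dw]; split => // H; apply: nX.
    by have : (C `&` D i) w by []; rewrite -XC => -[].
  by have : (X `&` D i) w by []; rewrite XC => -[].
- move=> X XC.
  have XC' n : exists C, natural_filtration W s C /\ X n `&` D i = C `&` D i.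
    by have [C] := XC n; exists C.
  have [C CP] := choice XC'.
  exists (\bigcup_n C n).
    by apply: sigma_process_bigcup => n; have [] := CP n.
  by rewrite !setI_bigcupl; apply: eq_bigcupr => n _; have [] := CP n.
Qed.

Let increment_event s t C B : (0 <= s)%R -> (s < t)%R ->
  natural_filtration W s C -> measurable B ->
  sigma_process W `[0%R, +oo[ (C `&` (fun w => W t w - W s w)%R @^-1` B).
Proof.
move=> s0 st WC mB; apply: sigma_processI.
  by move: WC; apply: sigma_process_le => r /=; rewrite !in_itv/= => /andP[->].
rewrite -[X in sigma_process _ _ X]setTI.
have mW r : (0 <= r)%R -> @measurable_fun _ _
    (g_sigma_algebraType (process_events W `[0%R, +oo[)) R setT (W r).
  by move=> r0; apply: sigma_process_measurable_fun; rewrite /= in_itv/= r0.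
have : @measurable_fun _ _ (g_sigma_algebraType (process_events W `[0%R, +oo[))
   R setT (fun w => W t w - W s w)%R.
  by apply: measurable_funB; apply: mW => //; exact: le_trans (ltW st).
by apply.
Qed.

(** [F s] need not contain the events of [theta], so two independences are used in turn: [A] is
    replaced by an event of [W], which splits off [D i], and then the increment is independent of
    [F s]. *)
Lemma brownian_increment_indep s t i A B : (0 <= s)%R -> (s < t)%R ->
  natural_filtration phi s A -> measurable B ->
  P (A `&` D i `&` (fun w => W t w - W s w)%R @^-1` B) =
  P (A `&` D i) * normal_prob 0 (Num.sqrt (t - s)) B.
Proof.
move=> s0 st phiA mB; have [C WC AC] := log_odds_trace i phiA.
have thD : preimage_set_system setT theta measurable (D i).
  by exists [set i] => //; rewrite setTI.
have WC' : sigma_process W `[0%R, +oo[ C.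
  by move: WC; apply: sigma_process_le => r /=; rewrite !in_itv/= => /andP[->].
rewrite AC [C `&` _]setIC -setIA indep_theta//; last exact: increment_event.
rewrite (indep_theta thD WC'); case: hW => _ _ _ hi hN.
rewrite (hi s t s0 st) ?hN//; first by rewrite muleA.
- exact: natural_filtration_brownian.
- by exists B => //; rewrite setTI.
Qed.

Lemma brownian_increment_integral s t i A (u : R * R -> \bar R) :
  (0 <= s)%R -> (s < t)%R -> natural_filtration phi s A ->
  measurable_fun [set: R * R] u -> (forall x, 0 <= u x) ->
  \int[P]_(w in A `&` D i) u (phi s w, (W t w - W s w)%R) =
  \int[P]_(w in A `&` D i) \int[normal_prob 0 (Num.sqrt (t - s))]_y u (phi s w, y).
Proof.
move=> s0 st phiA mu u0.
have mphi := measurable_log_odds s0.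
have mA : measurable A.
  by move: phiA; apply: natural_filtration_measurable; exact: measurable_log_odds.
apply: (@integral_independent _ _ _ P _ _ (phi s)
  (fun w => W t w - W s w)%R) => //.
- by apply: measurableI => //; exact: measurable_theta_event.
- by apply: measurable_funB; apply: measurable_brownian => //; exact: le_trans (ltW st).
move=> B1 B2 mB1 mB2.
rewrite !setIA [A `&` _ `&` _ @^-1` B1]setIAC.
rewrite brownian_increment_indep//.
by apply: sigma_processI => //; apply: sigma_process_preimage;
  rewrite //= in_itv/= s0 lexx.
Qed.

End likelihood.

(** * Change of measure between [theta = 0] and [theta = 1] *)

Section girsanov.
Local Open Scope ereal_scope.
Context {R : realType} {d : measure_display} {T : measurableType d}.
Variables (P : probability T R) (F : R -> set (set T)) (W : R -> T -> R).
Variables (theta : T -> R) (l m : R).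
Hypotheses (hF : filtration F) (hW : brownian_motion P F W).
Hypothesis mtheta : measurable_fun [set: T] theta.
Hypothesis indep_theta :
  independent P (preimage_set_system setT theta measurable)
    (sigma_process W `[0%R, +oo[).

Local Notation phi := (log_odds W theta l m).
Let D (i : R) : set T := theta @^-1` [set i].

(* The conditional expectation of [u (phi t)] given [theta = 1] and the past up
   to time [t - h], as a function of [phi (t - h)] and rewritten by the Gaussian
   shift as a weighted expectation under [theta = 0]. *)
Definition gauss_tilt (h : R) (u : R -> \bar R) (x : R) : \bar R :=
  \int[normal_prob 0 (Num.sqrt h)]_y
    (u (x + m * y - m ^+ 2 / 2 * h)%R * (expR (m * y - m ^+ 2 / 2 * h))%:E).

Lemma gauss_tilt_ge0 h (u : R -> \bar R) x :
  (forall x, 0 <= u x) -> 0 <= gauss_tilt h u x.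
Proof.
by move=> u0; apply: integral_ge0 => y _; rewrite mule_ge0// lee_fin expR_ge0.
Qed.

Let mlin (a b : R) : measurable_fun [set: R * R] (fun q : R * R => q.1 + a * q.2 + b)%R.
Proof.
by apply: measurable_funD => //; apply: measurable_funD => //; apply: measurable_funM.
Qed.

Let mexp (a b : R) : measurable_fun [set: R] (fun y => (expR (a * y + b))%:E).
Proof.
apply/measurable_EFinP; apply: measurableT_comp => //.
by apply: measurable_funD => //; exact: measurable_funM.
Qed.

Lemma measurable_gauss_tilt h (u : R -> \bar R) :
  measurable_fun [set: R] u -> (forall x, 0 <= u x) ->
  measurable_fun [set: R] (gauss_tilt h u).
Proof.
move=> mu u0.
pose f (q : R * R) := u (q.1 + m * q.2 + - (m ^+ 2 / 2 * h))%R *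
   (expR (m * q.2 + - (m ^+ 2 / 2 * h)))%:E.
have mf : measurable_fun [set: R * R] f.
  apply: emeasurable_funM; first exact: measurableT_comp.
  by apply: (measurableT_comp (mexp _ _)).
have f0 q : 0 <= f q by rewrite mule_ge0// lee_fin expR_ge0.
exact: (@measurable_fun_fubini_tonelli_F _ _ _ (measurableTypeR R) _
  (normal_prob 0 (Num.sqrt h)) f mf f0).
Qed.

(** Given [theta = 1], [phi] has drift [m^2 / 2] instead of [- m^2 / 2]. A Gaussian shift by
    [m * (t - s)] bridges the difference and creates the weight in [gauss_tilt]. *)
Lemma log_odds_step1 (s t : R) A (u : R -> \bar R) : (0 <= s)%R -> (s < t)%R ->
  natural_filtration phi s A -> measurable_fun [set: R] u -> (forall x, 0 <= u x) ->
  \int[P]_(w in A `&` D 1) u (phi t w) =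
  \int[P]_(w in A `&` D 1) gauss_tilt (t - s) u (phi s w).
Proof.
move=> s0 st phiA mu u0; have h0 : (0 < t - s)%R by rewrite subr_gt0.
pose f (q : R * R) := u (q.1 + m * q.2 + m ^+ 2 / 2 * (t - s))%R.
have mf : measurable_fun [set: R * R] f by exact: measurableT_comp.
transitivity (\int[P]_(w in A `&` D 1) f (phi s w, (W t w - W s w)%R)).
  apply: eq_integral => w; rewrite inE => -[_ Dw].
  by rewrite /f /= /log_odds Dw; congr u; field.
rewrite (brownian_increment_integral hF hW mtheta indep_theta)//; last first.
  by move=> q; exact: u0.
apply: eq_integral => w _; rewrite /gauss_tilt.
pose k y := u (phi s w + m * y + - (m ^+ 2 / 2 * (t - s)))%R.
have mk : measurable_fun [set: R] k.
  apply: measurableT_comp => //.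
  by apply: measurable_funD => //; apply: measurable_funD => //; exact: measurable_funM.
have sh : Num.sqrt (t - s) != 0%R by rewrite gt_eqF// sqrtr_gt0.
transitivity (\int[normal_prob 0 (Num.sqrt (t - s))]_y k (y + m * (t - s))%R).
  by apply: eq_integral => y _; rewrite /f /k /=; congr u; field.
rewrite (@integral_normal_shift _ (m * (t - s)) _ k sh mk (fun y => u0 _)).
apply: eq_integral => y _; rewrite /k; congr (_ * (expR _)%:E).
rewrite sqr_sqrtr ?ltW//; field.
by rewrite gt_eqF.
Qed.

(** Given [theta = 0], the growth factor of [expR phi] from [s] to [t] is exactly the weight in
    [gauss_tilt]. Thus [theta = 1] and [theta = 0] weighted by [expR phi] evolve by the same
    kernel. *)
Lemma log_odds_step0 (s t : R) A (u : R -> \bar R) : (0 <= s)%R -> (s < t)%R ->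
  natural_filtration phi s A -> measurable_fun [set: R] u -> (forall x, 0 <= u x) ->
  \int[P]_(w in A `&` D 0) ((expR (phi t w))%:E * u (phi t w)) =
  \int[P]_(w in A `&` D 0) ((expR (phi s w))%:E * gauss_tilt (t - s) u (phi s w)).
Proof.
move=> s0 st phiA mu u0; have h0 : (0 < t - s)%R by rewrite subr_gt0.
pose f (q : R * R) := (expR (q.1 + m * q.2 + - (m ^+ 2 / 2 * (t - s))))%:E *
  u (q.1 + m * q.2 + - (m ^+ 2 / 2 * (t - s)))%R.
have mf : measurable_fun [set: R * R] f.
  apply: emeasurable_funM; last exact: measurableT_comp.
  by apply/measurable_EFinP; exact: measurableT_comp.
transitivity (\int[P]_(w in A `&` D 0) f (phi s w, (W t w - W s w)%R)).
  apply: eq_integral => w; rewrite inE => -[_ Dw].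
  rewrite /f /=; have -> // : phi t w =
    (phi s w + m * (W t w - W s w) + - (m ^+ 2 / 2 * (t - s)))%R.
  by rewrite /log_odds Dw; ring.
rewrite (brownian_increment_integral hF hW mtheta indep_theta)//; last first.
  by move=> q; rewrite mule_ge0// lee_fin expR_ge0.
apply: eq_integral => w _; rewrite /gauss_tilt -ge0_integralZl//.
- apply: eq_integral => y _; rewrite /f /= -addrA expRD EFinM -muleA; congr (_ * _).
  by rewrite muleC addrA.
- apply: emeasurable_funM; last exact: mexp.
  apply: measurableT_comp => //.
  by apply: measurable_funB => //; apply: measurable_funD => //; apply: measurable_funM.
- by move=> y _; rewrite mule_ge0// lee_fin expR_ge0.
Qed.

Hypothesis odds : (expR l)%:E * P (D 0) = P (D 1).

(** Invariant of the induction on cylinder events. It ranges over all test functions because a time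
    step replaces [u] by [gauss_tilt h u] and an intersection multiplies it by an indicator. *)
Definition tilted (A : set T) (t : R) : Prop :=
  forall u : R -> \bar R, measurable_fun [set: R] u -> (forall x, 0 <= u x) ->
  \int[P]_(w in A `&` D 1) u (phi t w) =
  \int[P]_(w in A `&` D 0) ((expR (phi t w))%:E * u (phi t w)).

Lemma tilted_step (s t : R) A : (0 <= s)%R -> (s <= t)%R ->
  natural_filtration phi s A -> tilted A s -> tilted A t.
Proof.
move=> s0 st phiA As; have [stE|nst] := eqVneq s t; first by rewrite -stE.
have {nst}st' : (s < t)%R by rewrite lt_neqAle nst.
move=> u mu u0.
rewrite (log_odds_step1 s0 st')// (log_odds_step0 s0 st')//.
apply: As; first exact: measurable_gauss_tilt.
by move=> x; exact: gauss_tilt_ge0.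
Qed.

Lemma tilted_inter (s : R) A (B : set R) : measurable B ->
  tilted A s -> tilted (phi s @^-1` B `&` A) s.
Proof.
move=> mB As u mu u0.
have mB1 : measurable_fun [set: R] (fun x => (\1_B x)%:E : \bar R).
  exact/measurable_EFinP.
have muB : measurable_fun [set: R] (fun x => (\1_B x)%:E * u x).
  exact: emeasurable_funM.
have uB0 x : 0 <= (\1_B x)%:E * u x by rewrite mule_ge0// lee_fin.
have restr i (f : T -> \bar R) : \int[P]_(w in phi s @^-1` B `&` A `&` D i) f w =
    \int[P]_(w in A `&` D i) ((\1_B (phi s w))%:E * f w).
  rewrite -setIA setIC integral_mkcondr; apply: eq_integral => w _.
  rewrite patchE indicE; change (phi s w \in B) with (w \in phi s @^-1` B).
  by case: ifPn => _; rewrite ?mul1e ?mul0e.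
rewrite !restr; have /= -> := As _ muB uB0; apply: eq_integral => w _.
by rewrite muleCA.
Qed.

Fixpoint cylinder (L : seq (R * set R)) : set T :=
  if L is q :: L' then phi q.1 @^-1` q.2 `&` cylinder L' else setT.

(** Times decrease along the list, so the tail lies in the past of the head and the induction
    alternates [tilted_step] with [tilted_inter]. It starts at time 0, where [phi] is the constant
    [l] and the claim is [odds]. *)
Lemma tilted_cylinder L (t : R) : path (fun s r : R => r <= s)%R t (map fst L) ->
  (forall q, List.In q L -> (0 <= q.1)%R /\ measurable q.2) -> (0 <= t)%R ->
  natural_filtration phi t (cylinder L) /\ tilted (cylinder L) t.
Proof.
elim: L t => [|[s B] L IH] t /=.
  move=> _ _ t0; split; first exact: sigma_processT.
  apply: (@tilted_step 0 t) => //; first exact: sigma_processT.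
  move=> u mu u0.
  have phi0 w : phi 0 w = l.
    rewrite /log_odds; case: hW => _ _ -> _ _.
    by rewrite !mulr0 addr0 mulr0 addr0 subr0.
  under eq_integral do rewrite phi0.
  under [RHS]eq_integral do rewrite phi0.
  rewrite !setTI.
  have mD i : measurable (D i) by exact: measurable_theta_event.
  have -> : \int[P]_(_ in D 1) u l = u l * P (D 1) by exact: integral_cst.
  have -> : \int[P]_(_ in D 0) ((expR l)%:E * u l) = (expR l)%:E * u l * P (D 0).
    by exact: integral_cst.
  by rewrite -odds muleA [u l * _]muleC.
move=> /andP[st pL] LP t0.
have [s0 mB] := LP (s, B) (or_introl erefl); rewrite /= in s0 mB.
have [phiL tL] := IH s pL (fun q Hq => LP q (or_intror Hq)) s0.
have phiBL : natural_filtration phi s (phi s @^-1` B `&` cylinder L).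
  by apply: sigma_processI => //; apply: sigma_process_preimage;
    rewrite //= in_itv/= s0 lexx.
split; first exact: (natural_filtration_le st).
by apply: (@tilted_step s t) => //; exact: tilted_inter.
Qed.

Lemma cylinderE L w : cylinder L w <-> forall q, List.In q L -> q.2 (phi q.1 w).
Proof.
elim: L => [|q L IH] /=; first by split.
rewrite IH; split => [[Hq HL] r [<-//|/HL]//|H].
by split; [apply: H; left|move=> r Hr; apply: H; right].
Qed.

(** The times are unordered so that concatenating lists gives stability under intersection, as the
    pi-lambda argument requires. *)
Definition cylinders (t : R) : set (set T) :=
  [set cylinder L | L in [set L | forall q, List.In q L ->
    (0 <= q.1 <= t)%R /\ measurable q.2]].

Lemma in_seqP (L : seq (R * set R)) q : List.In q L <-> q \in L.
Proof.
elim: L => [|r L IH] //=; rewrite inE IH; split.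
  by move=> [->|->]; rewrite ?eqxx ?orbT.
by move=> /orP[/eqP ->|]; [left|right].
Qed.

Lemma tilted_cylinders t A : (0 <= t)%R -> cylinders t A ->
  natural_filtration phi t A /\ tilted A t.
Proof.
move=> t0 [L LP <-]; pose leT (q r : R * set R) := (r.1 <= q.1)%R.
(* An intersection does not depend on the order of its members, so the list may be sorted by
   decreasing time, as [tilted_cylinder] demands. *)
have -> : cylinder L = cylinder (sort leT L).
  by apply/seteqP; split => w /cylinderE H; apply/cylinderE => q /in_seqP;
    rewrite ?mem_sort => Hq; apply: H; apply/in_seqP; rewrite ?mem_sort.
have inL q : List.In q (sort leT L) -> (0 <= q.1 <= t)%R /\ measurable q.2.
  by move=> /in_seqP; rewrite mem_sort => /in_seqP; exact: LP.
apply: tilted_cylinder => //; last by move=> q /inL[/andP[]].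
have : sorted leT (sort leT L) by apply: sort_sorted => q r; exact: le_total.
move: inL; case: (sort leT L) => [//|q K] inL /=.
rewrite path_map => ->; rewrite andbT.
by have [/andP[]] := inL q (or_introl erefl).
Qed.

Let mphi s : (0 <= s)%R -> measurable_fun [set: T] (phi s).
Proof. exact: (measurable_log_odds l m hF hW mtheta). Qed.

Lemma girsanov_event t A : (0 <= t)%R -> natural_filtration phi t A ->
  P (A `&` D 1) = \int[P]_(w in A `&` D 0) (expR (phi t w))%:E.
Proof.
move=> t0 phiA.
have mD i : measurable (D i) by exact: measurable_theta_event.
have mE : measurable_fun [set: T] (fun w => expR (phi t w)).
  by apply: measurableT_comp => //; exact: mphi.
pose m1 : {measure set T -> \bar R} := mrestr P (mD 1%R).
pose m2 : {measure set T -> \bar R} :=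
  mrestr (density_measure P mE (fun w => expR_ge0 _)) (mD 0%R).
have GT : cylinders t setT by exists [::].
have m12 B : cylinders t B -> m1 B = m2 B.
  move=> /(tilted_cylinders t0)[phiB] /(_ (cst 1) (measurable_cst _) (fun=> lee01)).
  have mB : measurable (B `&` D 1).
    by apply: measurableI => //; exact: natural_filtration_measurable phiB.
  have -> : \int[P]_(w in B `&` D 1) (cst 1 (phi t w)) = P (B `&` D 1).
    by rewrite -[RHS]mul1e; exact: (integral_cst P mB 1).
  move=> e; change (P (B `&` D 1) = \int[P]_(w in B `&` D 0) (expR (phi t w))%:E).
  rewrite e.
  by apply: eq_integral => w _; rewrite mule1.
suff /(_ A) : forall E, <<s cylinders t>> E -> m1 E = m2 E.
  apply; move: phiA; apply: sigma_process_min; first exact: smallest_sigma_algebra.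
  move=> s B /=; rewrite in_itv/= => st mB; apply: sub_sigma_algebra.
  exists [:: (s, B)]; last by rewrite /= setIT.
  by move=> q [<-|[]].
apply: (@g_sigma_algebra_measure_unique _ _ _ (cylinders t) _ (fun=> setT)) => //.
- move=> B /(tilted_cylinders t0)[+ _]; exact: natural_filtration_measurable.
- by rewrite bigcup_const.
- move=> B C [L LP <-] [L' L'P <-]; exists (L ++ L').
    by move=> q Hq; have [/LP|/L'P] := List.in_app_or _ _ _ Hq.
  apply/seteqP; split => w.
    move=> /cylinderE H; split; apply/cylinderE => q Hq; apply: H;
      apply: List.in_or_app; by [left|right].
  move=> [/cylinderE H /cylinderE H']; apply/cylinderE => q Hq.
  by have [/H|/H'] := List.in_app_or _ _ _ Hq.
- move=> _; change (P (setT `&` D 1) < +oo).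
  by rewrite setTI (le_lt_trans (probability_le1 _ _)) ?ltry.
Qed.

(** Applying [girsanov_event] to [A] intersected with preimages under [phi t] shows that [expR] is
    the density between the two restricted laws of [phi t]. *)
Lemma girsanov t A (f : R -> \bar R) : (0 <= t)%R -> natural_filtration phi t A ->
  measurable_fun [set: R] f -> (forall x, 0 <= f x) ->
  \int[P]_(w in A `&` D 1) f (phi t w) =
  \int[P]_(w in A `&` D 0) (f (phi t w) * (expR (phi t w))%:E).
Proof.
move=> t0 phiA mf f0.
have mphit := mphi t0.
have mA : measurable A.
  by move: phiA; exact: natural_filtration_measurable.
have mAD i : measurable (A `&` D i).
  by apply: measurableI => //; exact: measurable_theta_event.
have mex : measurable_fun [set: measurableTypeR R] (@expR R) by exact: measurable_expR.
have /= := @ge0_integral_density _ _ _ (restricted_law P (mAD 0%R) mphit)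
  (restricted_law P (mAD 1%R) mphit) (@expR R) mex (@expR_ge0 R) _ f mf f0.
have mfe : measurable_fun [set: R] (fun x => f x * (expR x)%:E).
  by apply: emeasurable_funM => //; exact/measurable_EFinP.
rewrite !ge0_integral_restricted_law//; last first.
  by move=> x; rewrite mule_ge0// lee_fin expR_ge0.
rewrite preimage_setT !setIT; apply => B mB.
have phiAB : natural_filtration phi t (A `&` phi t @^-1` B).
  by apply: sigma_processI => //; apply: sigma_process_preimage;
    rewrite //= in_itv/= t0 lexx.
rewrite ge0_integral_restricted_law//; last exact/measurable_EFinP.
rewrite [RHS](_ : _ = P (A `&` phi t @^-1` B `&` D 1)); last first.
  by rewrite (girsanov_event t0 phiAB) setIAC.
by rewrite /restricted_law /pushforward /mrestr setIC setIAC.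
Qed.

End girsanov.

(** * Martingales of the log-odds process *)

Section bayes_martingale.
Context {R : realType}.

Definition logistic (x : R) : R := expR x / (1 + expR x).

(* With [y = logistic x], this is
   [exp (m^2 a (1 - a) t / 2) * y^a * (1 - y)^(1 - a)]. *)
Definition bayes_martingale (m a t x : R) : R :=
  expR (m ^+ 2 * a * (1 - a) / 2 * t + a * x) / (1 + expR x).

Let e1 (x : R) : 0 < 1 + expR x.
Proof. by rewrite addr_gt0// expR_gt0. Qed.

Lemma bayes_martingale_ge0 m a t x : 0 <= bayes_martingale m a t x.
Proof. by rewrite divr_ge0 ?expR_ge0// ltW. Qed.

Lemma bayes_martingale1 m t x : bayes_martingale m 1 t x = logistic x.
Proof. by rewrite /bayes_martingale subrr mulr0 !mul0r add0r mul1r. Qed.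

Lemma cvg_expR (U : Type) (FU : set_system U) {FF : Filter FU} (f : U -> R) (x : R) :
  f @ FU --> x -> expR (f u) @[u --> FU] --> expR x.
Proof. by move=> fx; apply: (cvg_comp _ _ fx); exact: continuous_expR. Qed.

Lemma cvg_bayes_martingale m a (U : Type) (FU : set_system U) {FF : Filter FU}
    (f g : U -> R) (t x : R) : f @ FU --> t -> g @ FU --> x ->
  bayes_martingale m a (f u) (g u) @[u --> FU] --> bayes_martingale m a t x.
Proof.
move=> ft gx; apply: cvgM.
  apply: cvg_expR; apply: cvgD; apply: cvgM => //; exact: cvg_cst.
apply: cvgV; first by rewrite gt_eqF.
by apply: cvgD; [exact: cvg_cst|exact: cvg_expR].
Qed.

Lemma measurable_bayes_martingale m a t :
  measurable_fun [set: R] (bayes_martingale m a t).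
Proof.
apply: continuous_measurable_fun => x.
by apply: cvg_bayes_martingale; [exact: cvg_cst|exact: cvg_id].
Qed.

Lemma logistic_gt0 x : 0 < logistic x.
Proof. by rewrite divr_gt0 ?expR_gt0. Qed.

Lemma logistic_lt1 x : logistic x < 1.
Proof. by rewrite ltr_pdivrMr// mul1r ltrDr. Qed.

Lemma cvg_logistic (U : Type) (FU : set_system U) {FF : Filter FU}
    (g : U -> R) (x : R) : g @ FU --> x ->
  logistic (g u) @[u --> FU] --> logistic x.
Proof.
move=> gx; rewrite -(bayes_martingale1 0 0).
under eq_fun do rewrite -(bayes_martingale1 0 0).
by apply: cvg_bayes_martingale => //; exact: cvg_cst.
Qed.

Lemma measurable_logistic : measurable_fun [set: R] logistic.
Proof. by apply: continuous_measurable_fun => x; apply: cvg_logistic; exact: cvg_id. Qed.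

(** As [0 <= a <= 1], [a * x] is at most the larger of [0] and [x], so [expR (a * x)] is at most
    [1 + expR x] and only the time factor survives. *)
Lemma bayes_martingale_le m a t b x : 0 <= a <= 1 -> 0 <= t <= b ->
  bayes_martingale m a t x <= expR (m ^+ 2 * a * (1 - a) / 2 * b).
Proof.
move=> /andP[a0 a1] /andP[t0 tb]; rewrite ler_pdivrMr// expRD.
have k0 : 0 <= m ^+ 2 * a * (1 - a) / 2.
  by rewrite divr_ge0// mulr_ge0 ?subr_ge0// mulr_ge0// sqr_ge0.
apply: ler_pM; rewrite ?expR_ge0// ?ler_expR ?ler_wpM2l//.
have [x0|x0] := leP 0 x.
  rewrite (@le_trans _ _ (expR x))// ?lerDr//.
  by rewrite ler_expR ler_piMl.
rewrite (@le_trans _ _ (1 : R))// ?lerDl ?expR_ge0//.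
by rewrite -expR0 ler_expR mulr_ge0_le0// ltW.
Qed.

End bayes_martingale.

Section bayes.
Local Open Scope ereal_scope.
Context {R : realType} {d : measure_display} {T : measurableType d}.
Variables (P : probability T R) (F : R -> set (set T)) (W : R -> T -> R).
Variables (theta : T -> R) (l m : R).
Hypotheses (hF : filtration F) (hW : brownian_motion P F W).
Hypothesis mtheta : measurable_fun [set: T] theta.
Hypothesis theta01 : forall w, theta w = 0%R \/ theta w = 1%R.
Hypothesis indep_theta :
  independent P (preimage_set_system setT theta measurable)
    (sigma_process W `[0%R, +oo[).

Local Notation phi := (log_odds W theta l m).
Local Notation D := (fun i : R => theta @^-1` [set i]).
Hypothesis odds : (expR l)%:E * P (D 0%R) = P (D 1%R).

Let mphi s : (0 <= s)%R -> measurable_fun [set: T] (phi s).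
Proof. exact: (measurable_log_odds l m hF hW mtheta). Qed.

Lemma natural_filtration_log_odds_measurable t :
  natural_filtration phi t `<=` measurable.
Proof. exact: natural_filtration_measurable. Qed.

(** Splitting by [theta] and moving the part [theta = 1] by [girsanov] expresses the mixture through
    [theta = 0] alone, where [phi] has constant drift. *)
Lemma integral_given_theta0 t A (f : R -> \bar R) : (0 <= t)%R ->
  natural_filtration phi t A -> measurable_fun [set: R] f -> (forall x, 0 <= f x) ->
  \int[P]_(w in A) f (phi t w) =
  \int[P]_(w in A `&` D 0%R) (f (phi t w) * (1 + expR (phi t w))%:E).
Proof.
move=> t0 phiA mf f0.
have mA := natural_filtration_log_odds_measurable phiA.
have mAD i : measurable (A `&` D i).
  by apply: measurableI => //; exact: measurable_theta_event.
have mfphi : measurable_fun [set: T] (fun w => f (phi t w)).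
  by apply: measurableT_comp => //; exact: mphi.
have mephi : measurable_fun [set: T] (fun w => (expR (phi t w))%:E : \bar R).
  by apply/measurable_EFinP; apply: measurableT_comp => //; exact: mphi.
have AE : A = (A `&` D 0%R) `|` (A `&` D 1%R).
  rewrite -setIUr; apply/seteqP; split => w; last by case.
  by move=> Aw; split => //=; exact: theta01.
rewrite {1}AE ge0_integral_setU//=; last 2 first.
- exact: measurable_funTS.
- apply/disj_set2P/seteqP; split => // w /= [[_ ->] [_ /esym]].
  by move=> /eqP; rewrite oner_eq0.
rewrite (girsanov hF hW mtheta indep_theta odds t0 phiA mf f0).
rewrite -ge0_integralD//=; last 3 first.
- exact: measurable_funTS.
- by move=> w _; rewrite mule_ge0// lee_fin expR_ge0.
- by apply: measurable_funTS; exact: emeasurable_funM.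
apply: eq_integral => w _.
by rewrite EFinD ge0_muleDr ?lee_fin ?expR_ge0// mule1.
Qed.

(** Since [logistic x * (1 + expR x) = expR x], the previous lemma turns the left side into that of
    [girsanov_event]. *)
Lemma bayes t A : (0 <= t)%R -> natural_filtration phi t A ->
  \int[P]_(w in A) (logistic (phi t w))%:E = P (A `&` D 1%R).
Proof.
move=> t0 phiA.
have e1 x : (0 < 1 + expR x :> R)%R by rewrite addr_gt0// expR_gt0.
rewrite (@integral_given_theta0 _ _ (EFin \o logistic) t0 phiA); last 2 first.
- by apply/measurable_EFinP; exact: measurable_logistic.
- by move=> x; rewrite lee_fin divr_ge0 ?expR_ge0 ?ltW.
rewrite (girsanov_event hF hW mtheta indep_theta odds t0 phiA).
apply: eq_integral => w _; rewrite -EFinM divfK// gt_eqF//.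
Qed.

(** The denominator cancels against the weight [1 + expR phi]. Given [theta = 0], the increment of
    [a * phi] contributes, per unit of time, [- a m^2 / 2] through its drift and [a^2 m^2 / 2]
    through the Gaussian moment; this offsets the coefficient of [t] in [bayes_martingale]. *)
Lemma bayes_martingaleP a s t A : (0 <= s)%R -> (s <= t)%R ->
  natural_filtration phi s A ->
  \int[P]_(w in A) (bayes_martingale m a t (phi t w))%:E =
  \int[P]_(w in A) (bayes_martingale m a s (phi s w))%:E.
Proof.
move=> s0 st phiA; have t0 := le_trans s0 st.
have e1 x : (0 < 1 + expR x :> R)%R by rewrite addr_gt0// expR_gt0.
have key r : (0 <= r)%R -> natural_filtration phi r A ->
  \int[P]_(w in A) (bayes_martingale m a r (phi r w))%:E =
  \int[P]_(w in A `&` D 0%R) (expR (m ^+ 2 * a * (1 - a) / 2 * r + a * phi r w))%:E.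
  move=> r0 phirA.
  rewrite (@integral_given_theta0 _ _ (EFin \o bayes_martingale m a r) r0 phirA); last 2 first.
  - by apply/measurable_EFinP; exact: measurable_bayes_martingale.
  - by move=> x; rewrite lee_fin bayes_martingale_ge0.
  apply: eq_integral => w _; rewrite -EFinM divfK// gt_eqF//.
rewrite (key t)//; last exact: (natural_filtration_le st).
rewrite (key s)//.
have [<-//|nst] := eqVneq s t.
have {nst}st' : (s < t)%R by rewrite lt_neqAle nst.
have h0 : (0 < t - s)%R by rewrite subr_gt0.
pose k := (m ^+ 2 * a * (1 - a) / 2)%R.
pose f (q : R * R) : \bar R :=
  (expR (k * t + a * (q.1 + m * q.2 - m ^+ 2 / 2 * (t - s))))%:E.
transitivity (\int[P]_(w in A `&` D 0%R) f (phi s w, (W t w - W s w)%R)).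
  apply: eq_integral => w; rewrite inE => -[_ Dw].
  rewrite /f /k /=; congr (expR (_ + _ * _))%:E.
  by rewrite /log_odds Dw; ring.
rewrite (brownian_increment_integral hF hW mtheta indep_theta)//; last 2 first.
- apply/measurable_EFinP; apply: measurableT_comp => //.
  apply: measurable_funD => //; apply: measurable_funM => //.
  by apply: measurable_funB => //; apply: measurable_funD => //; exact: measurable_funM.
- by move=> q; rewrite lee_fin expR_ge0.
apply: eq_integral => w _.
have sh : Num.sqrt (t - s) != 0%R by rewrite gt_eqF// sqrtr_gt0.
transitivity ((expR (k * t + a * (phi s w - m ^+ 2 / 2 * (t - s))))%:E *
  \int[normal_prob 0 (Num.sqrt (t - s))]_y (expR (a * m * y))%:E).
  rewrite -ge0_integralZl//.
  - by apply: eq_integral => y _; rewrite /f /= -EFinM -expRD; congr (expR _)%:E; ring.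
  - apply/measurable_EFinP; apply: measurableT_comp => //; exact: measurable_funM.
rewrite normal_prob_mgf// -EFinM -expRD; congr (expR _)%:E.
by rewrite sqr_sqrtr ?ltW// /k; field.
Qed.

End bayes.

(** * Discretised times and continuous paths *)

Section time_grid.
Context {R : realType}.
Implicit Types (t : R) (n j : nat).

(** Times are rounded up so that a rounded stopping time is again one: whether the index is at most
    [j] is decided at time [j / n.+1]. *)
Definition grid_index n t : nat := `|Num.ceil (n.+1%:R * t)|%N.

Definition grid n t : R := (grid_index n t)%:R / n.+1%:R.

Lemma grid_index_le n t j : 0 <= t -> (grid_index n t <= j)%N = (n.+1%:R * t <= j%:R).
Proof.
move=> t0.
have c0 : 0 <= Num.ceil (n.+1%:R * t).
  by rewrite ceil_ge0 (lt_le_trans (ltrN10 _))// mulr_ge0.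
rewrite -lez_nat gez0_abs// ceil_le_int//.
Qed.

Lemma grid_ge n t : 0 <= t -> t <= grid n t.
Proof. by move=> t0; rewrite ler_pdivlMr// mulrC -grid_index_le. Qed.

Lemma grid_lt n t : 0 <= t -> grid n t < t + n.+1%:R^-1.
Proof.
move=> t0; rewrite ltr_pdivrMr// mulrDl mulVf// mulrC.
have [->|i0] := posnP (grid_index n t).
  by rewrite ltr_wpDl// mulr_ge0.
have : ~~ (grid_index n t <= (grid_index n t).-1)%N by rewrite -ltnNge prednK.
rewrite grid_index_le// -ltNge -(ltrD2r 1) => /le_lt_trans; apply.
by rewrite natr1 prednK.
Qed.

Lemma grid_ge0 n t : 0 <= grid n t.
Proof. by rewrite divr_ge0. Qed.

Lemma cvg_grid t : 0 <= t -> grid n t @[n --> \oo] --> t.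
Proof.
move=> t0; apply: (@squeeze_cvgr _ _ _ _ (cst t) (fun n => t + n.+1%:R^-1)).
- by apply: nearW => n; rewrite grid_ge// ltW// grid_lt.
- exact: cvg_cst.
- by rewrite -[X in _ --> X]addr0; apply: cvgD; [exact: cvg_cst|exact: cvg_harmonic].
Qed.

End time_grid.

Section paths.
Context {R : realType} {d : measure_display} {T : measurableType d}.
Implicit Types Z : R -> T -> R.

Lemma continuous_paths_cvg Z (u : nat -> R) (t : R) w : continuous_paths Z ->
  (forall n, 0 <= u n) -> u @ \oo --> t -> Z (u n) w @[n --> \oo] --> Z t w.
Proof.
move=> cZ u0 ut.
have t0 : 0 <= t.
  by apply: (cvgr_to_ge ut); exact: nearW.
have /subspace_continuousP/(_ t) := cZ w.
rewrite /= in_itv/= andbT => /(_ t0) h; apply: (cvg_comp _ _ _ h).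
move=> A; rewrite /within/= => /ut uA.
have {}uA : \forall n \near \oo, `[0, +oo[%classic (u n) -> A (u n) by exact: uA.
by apply: filterS uA => n; apply; rewrite /= in_itv/= u0.
Qed.

Lemma natural_filtration_comp Z Z' (f : R -> R -> R) (t : R) :
  (forall s, 0 <= s -> measurable_fun [set: R] (f s)) ->
  (forall s w, 0 <= s -> Z' s w = f s (Z s w)) ->
  natural_filtration Z' t `<=` natural_filtration Z t.
Proof.
move=> mf Z'E; apply: sigma_process_min; first exact: smallest_sigma_algebra.
move=> s B /=; rewrite in_itv/= => /andP[s0 st] mB.
rewrite (_ : _ @^-1` _ = Z s @^-1` (f s @^-1` B)).
  apply: sigma_process_preimage; first by rewrite /= in_itv/= s0.
  by rewrite -[X in measurable X]setTI; exact: mf.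
by apply/seteqP; split => w /=; rewrite Z'E.
Qed.

(** One null set serves the countably many grid times; continuity along [grid n t] does the rest. *)
Lemma ae_eq_paths (P : probability T R) Z Z' :
  continuous_paths Z -> continuous_paths Z' ->
  (forall t, 0 <= t -> {ae P, forall w, Z t w = Z' t w}) ->
  {ae P, forall w, forall t, 0 <= t -> Z t w = Z' t w}.
Proof.
move=> cZ cZ' ZZ'.
have : {ae P, forall w, forall n i : nat, Z (i%:R / n.+1%:R) w = Z' (i%:R / n.+1%:R) w}.
  apply: ae_foralln => n; apply: ae_foralln => i.
  by apply: ZZ'; rewrite divr_ge0.
apply: filterS => w ZZ'w t t0.
have g0 n := grid_ge0 n t.
have c1 := continuous_paths_cvg (w := w) cZ g0 (cvg_grid t0).
have c2 := continuous_paths_cvg (w := w) cZ' g0 (cvg_grid t0).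
have E : (fun n => Z (grid n t) w) = (fun n => Z' (grid n t) w).
  by apply/funext => n; rewrite /grid ZZ'w.
rewrite -E in c2.
exact: (cvg_unique (@Rhausdorff R) c1 c2).
Qed.

End paths.

(** * Identification of the posterior with the logistic of the log-odds *)

Section posterior.
Local Open Scope ereal_scope.
Context {R : realType} {d : measure_display} {T : measurableType d}.
Variables (P : probability T R) (F : R -> set (set T)) (W : R -> T -> R).
Variables (theta : T -> R) (Z : R -> T -> R) (alpha sigma p : R).
Hypotheses (alpha0 : alpha != 0%R) (sigma0 : (0 < sigma)%R) (p01 : (0 < p < 1)%R).
Hypothesis model : signal_model alpha sigma p P F W theta Z.

Local Notation m := (alpha / sigma)%R.
Local Notation l := (ln (p / (1 - p)))%R.
Local Notation phi := (log_odds W theta l m).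
Local Notation X := (signal alpha sigma theta W).
Local Notation D := (fun i : R => theta @^-1` [set i]).

Let hF := model_filtration model.
Let hW := model_brownian model.
Let mtheta := model_theta_measurable model.
Let th01 := model_theta01 model.
Let indep := model_independent model.

Let mD i : measurable (D i).
Proof. exact: measurable_theta_event. Qed.

Lemma prior_odds : (expR l)%:E * P (D 0%R) = P (D 1%R).
Proof.
have /andP[p0 p1] := p01.
have D0E : D 0%R = ~` D 1%R.
  apply/seteqP; split => w /=; first by move=> -> /esym/eqP; rewrite oner_eq0.
  by have [] := th01 w.
have -> : P (D 0%R) = (1 - p)%:E.
  by rewrite D0E probability_setC// (model_prior model) EFinB.
rewrite lnK ?posrE ?divr_gt0 ?subr_gt0// (model_prior model) -EFinM divfK//.
by rewrite gt_eqF ?subr_gt0.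
Qed.

Lemma log_odds_signal t w : phi t w = (l + alpha / sigma ^+ 2 * X t w - m ^+ 2 / 2 * t)%R.
Proof. by rewrite /log_odds /signal; field; rewrite gt_eqF. Qed.

Lemma natural_filtration_signal t :
  natural_filtration X t = natural_filtration phi t.
Proof.
have ms := lt0r_neq0 sigma0.
apply/seteqP; split.
  apply: (@natural_filtration_comp _ _ _ _ _ (fun s x =>
    (x - l + m ^+ 2 / 2 * s) * (sigma ^+ 2 / alpha))%R).
    move=> s s0 /=; apply: measurable_funM => //.
    by apply: measurable_funD => //; exact: measurable_funB.
  by move=> s w s0; rewrite log_odds_signal; field; rewrite ms alpha0.
apply: (@natural_filtration_comp _ _ _ _ _ (fun s x =>
  l + alpha / sigma ^+ 2 * x - m ^+ 2 / 2 * s)%R).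
  by move=> s s0 /=; apply: measurable_funB => //; apply: measurable_funD => //; exact: measurable_funM.
by move=> s w s0; rewrite log_odds_signal.
Qed.

Lemma continuous_log_odds : continuous_paths phi.
Proof.
have [_ cW _ _ _] := hW.
move=> w; apply/subspace_continuousP => t /= t0.
have /subspace_continuousP/(_ t t0) := cW w => cWt.
apply: cvgB.
  apply: cvgD; first exact: cvg_cst.
  apply: cvgM; first exact: cvg_cst.
  apply: cvgD; last exact: cWt.
  apply: cvgM; first exact: cvg_cst.
  exact: cvg_within.
apply: cvgM; first exact: cvg_cst.
exact: cvg_within.
Qed.

(** The difference [h] of the two candidates is measurable for the signal up to [t] and integrates
    to zero over each of its events. The events [h >= 0] and [h < 0] then give [E |h| = 0]. *)
Lemma posterior_at t : (0 <= t)%R -> {ae P, forall w, Z t w = logistic (phi t w)}.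
Proof.
move=> t0; have [/(_ t t0) [YX iY YD] _ _] := model_posterior model.
rewrite natural_filtration_signal in YX YD.
have mFphi : natural_filtration phi t `<=` measurable.
  apply: natural_filtration_measurable => s s0.
  exact: (measurable_log_odds l m hF hW mtheta).
pose L w := logistic (phi t w); pose h w := (L w - Z t w)%R.
have mh : @measurable_fun _ _ (g_sigma_algebraType (process_events phi `[0%R, t])) R setT h.
  apply: measurable_funB.
    apply: measurableT_comp; first exact: measurable_logistic.
    by apply: sigma_process_measurable_fun; rewrite /= in_itv/= t0 lexx.
  by move=> _ B mB; apply: YX; exists B.
have mL : measurable_fun [set: T] L.
  apply: measurableT_comp; first exact: measurable_logistic.
  exact: (measurable_log_odds l m hF hW mtheta).
have iL : P.-integrable setT (EFin \o L).
  apply: measurable_bounded_integrable => //.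
    by rewrite (le_lt_trans (probability_le1 _ _)) ?ltry.
  exists 1%R; split => // x x1 w _ /=.
  by rewrite ger0_norm ?(ltW (logistic_gt0 _))// (le_trans (ltW (logistic_lt1 _))) ?ltW.
have h0 C : natural_filtration phi t C -> \int[P]_(w in C) (h w)%:E = 0.
  move=> XC; have mC := mFphi _ XC.
  under eq_integral do rewrite EFinB.
  rewrite integralB//; last 2 first.
  - exact: integrableS iL.
  - exact: integrableS iY.
  rewrite YD//= (bayes hF hW mtheta th01 indep prior_odds t0 XC).
  by rewrite subee// fin_num_measure//; apply: measurableI.
have XB (B : set R) : measurable B -> natural_filtration phi t (h @^-1` B).
  by move=> mB; rewrite -[X in natural_filtration _ _ X]setTI; exact: mh.
have mhT : measurable_fun [set: T] (EFin \o h).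
  by apply/measurable_EFinP => _ B mB; rewrite setTI; apply: mFphi; exact: XB.
suff : ae_eq P setT (EFin \o h) (cst 0).
  by apply: filterS => w /(_ I) [] /eqP; rewrite subr_eq0 => /eqP.
apply/ae_eq_integral_abs => //.
pose B := h @^-1` `[0%R, +oo[.
have FB : natural_filtration phi t B by exact: XB.
rewrite -(setUv B) ge0_integral_setU//; last 4 first.
- exact: mFphi.
- by apply: measurableC; exact: mFphi.
- by apply: measurable_funTS; exact: measurableT_comp.
- by apply/disj_set2P; rewrite setICr.
rewrite [X in X + _](_ : _ = 0); last first.
  rewrite -(h0 B)//; apply: eq_integral => w; rewrite inE /B /= in_itv/= andbT => hw.
  by rewrite ger0_norm.
rewrite [X in _ + X](_ : _ = 0) ?adde0//.
apply/eqP; rewrite -oppe_eq0 -integral_ge0N//; apply/eqP.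
rewrite -(h0 (~` B)); last exact: sigma_processC.
apply: eq_integral => w; rewrite inE /B /= in_itv/= andbT => /negP; rewrite -ltNge => hw.
by rewrite ltr0_norm//= opprK.
Qed.

Lemma posterior_logistic :
  {ae P, forall w, forall t, (0 <= t)%R -> Z t w = logistic (phi t w)}.
Proof.
apply: (@ae_eq_paths _ _ _ _ Z (fun t w => logistic (phi t w))).
- by have [] := model_posterior model.
- move=> w; apply/subspace_continuousP => t t0.
  apply: cvg_logistic.
  by have /subspace_continuousP := @continuous_log_odds w; exact.
- exact: posterior_at.
Qed.

End posterior.

(** * Optional stopping *)

Section sigma_algebra_closure.
Context {d : measure_display} {T : measurableType d} (S : set (set T)).
Hypothesis sS : sigma_algebra setT S.

Let SE : <<s S >> = S := sigma_algebra_id sS.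

Lemma sigma_algebra_setT : S setT.
Proof. by rewrite -SE; exact: (@measurableT _ (g_sigma_algebraType S)). Qed.

Lemma sigma_algebra_setD A B : S A -> S B -> S (A `\` B).
Proof. by rewrite -SE; exact: (@measurableD _ (g_sigma_algebraType S)). Qed.

Lemma sigma_algebra_setU A B : S A -> S B -> S (A `|` B).
Proof. by rewrite -SE; exact: (@measurableU _ (g_sigma_algebraType S)). Qed.

End sigma_algebra_closure.

Section stopped_process.
Context {R : realType} {d : measure_display} {T : measurableType d}.
Implicit Types (Z : R -> T -> R) (tau : T -> R).

Lemma grid_index_preimage tau (n j : nat) : (forall w, 0 <= tau w) ->
  [set w | grid_index n (tau w) = j] =
  [set w | tau w <= j%:R / n.+1%:R] `\`
  (if j is j'.+1 then [set w | tau w <= j'%:R / n.+1%:R] else set0).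
Proof.
move=> tau0.
have le k w : (tau w <= k%:R / n.+1%:R) = (grid_index n (tau w) <= k)%N.
  by rewrite grid_index_le// ler_pdivlMr// mulrC.
apply/seteqP; split => [w /= <-|w /=]; rewrite le.
  split; first by [].
  by case E : (grid_index n (tau w)) => [|j'] /=; [case|rewrite le E ltnn].
case: j => [|j] /= [ij Nij].
  by move: ij; rewrite leqn0 => /eqP.
by move/negP: Nij; rewrite le -ltnNge => ji; apply/eqP; rewrite eqn_leq ij.
Qed.

Lemma measurable_le_preimage tau (t : R) : measurable_fun [set: T] tau ->
  measurable [set w | tau w <= t].
Proof.
move=> mtau; rewrite (_ : [set w | _] = tau @^-1` `]-oo, t]).
  by rewrite -[X in measurable X]setTI; exact: mtau.
by apply/seteqP; split => w /=; rewrite in_itv.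
Qed.

Lemma measurable_of_le_preimage tau : (forall w, 0 <= tau w) ->
  (forall t, 0 <= t -> measurable [set w | tau w <= t]) -> measurable_fun [set: T] tau.
Proof.
move=> tau0 mtau; apply: (measurability (@RGenOInfty.G R)) => [|/= _ [_] [r] -> <-].
  exact: RGenOInfty.measurableE.
rewrite setTI (_ : _ @^-1` _ = ~` [set w | tau w <= r]); last first.
  by apply/seteqP; split => w /=; rewrite in_itv/= andbT ltNge => /negP.
apply: measurableC; have [/mtau//|r0] := leP 0 r.
rewrite (_ : [set w | _] = set0)//; apply/seteqP; split => // w /= /le_lt_trans/(_ r0).
by rewrite ltNge tau0.
Qed.

Lemma measurable_grid_stopped Z tau n :
  (forall t, 0 <= t -> measurable_fun [set: T] (Z t)) ->
  measurable_fun [set: T] tau -> (forall w, 0 <= tau w) ->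
  measurable_fun [set: T] (fun w => Z (grid n (tau w)) w).
Proof.
move=> mZ mtau tau0 _ B mB; rewrite setTI.
rewrite (_ : _ @^-1` _ = \bigcup_j ([set w | grid_index n (tau w) = j] `&`
  Z (j%:R / n.+1%:R) @^-1` B)); last first.
  apply/seteqP; split => w /=; first by move=> BZ; exists (grid_index n (tau w)).
  by move=> [j _ [<-]].
apply: bigcupT_measurable => j; apply: measurableI.
  rewrite grid_index_preimage//; apply: measurableD; first exact: measurable_le_preimage.
  by case: j => // j; exact: measurable_le_preimage.
by rewrite -[X in measurable X]setTI; apply: mZ => //; rewrite divr_ge0.
Qed.

Lemma measurable_stopped Z tau : continuous_paths Z ->
  (forall t, 0 <= t -> measurable_fun [set: T] (Z t)) ->
  measurable_fun [set: T] tau -> (forall w, 0 <= tau w) ->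
  measurable_fun [set: T] (fun w => Z (tau w) w).
Proof.
move=> cZ mZ mtau tau0.
apply: (@measurable_fun_cvg _ _ _ _ (fun n w => Z (grid n (tau w)) w)).
  by move=> n; exact: measurable_grid_stopped.
move=> w _; apply: (continuous_paths_cvg (w := w) cZ); last exact: cvg_grid.
by move=> n; exact: grid_ge0.
Qed.

End stopped_process.

Section optional_stopping.
Local Open Scope ereal_scope.
Context {R : realType} {d : measure_display} {T : measurableType d}.
Variables (P : probability T R) (G : R -> set (set T)) (M : R -> T -> R).
Hypothesis hG : filtration G.
Hypothesis cM : continuous_paths M.
Hypothesis mM : forall t, (0 <= t)%R -> measurable_fun [set: T] (M t).
Hypothesis M0 : forall t w, (0 <= M t w)%R.
Hypothesis martM : forall s t A, (0 <= s)%R -> (s <= t)%R -> G s A ->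
  \int[P]_(w in A) (M t w)%:E = \int[P]_(w in A) (M s w)%:E.

Lemma optional_stopping (tau : T -> R) (b c : R) :
  (forall w, (0 <= tau w <= b)%R) ->
  (forall t, (0 <= t)%R -> G t [set w | (tau w <= t)%R]) ->
  (forall t w, (0 <= t <= b + 1)%R -> (M t w <= c)%R) ->
  \int[P]_w (M (tau w) w)%:E = \int[P]_w (M 0 w)%:E.
Proof.
move=> tau0b Gtau Mc; have [sG Gm Gle] := hG.
have tau0 w : (0 <= tau w)%R by have /andP[] := tau0b w.
have b0 : (0 <= b)%R by have /andP[/le_trans] := tau0b point; apply.
have mtau : measurable_fun [set: T] tau.
  by apply: measurable_of_le_preimage => // t t_ge0; exact: Gm (Gtau t t_ge0).
(* Rounding up adds at most [1 / n.+1 <= 1]; this is the origin of the horizon [b + 1]. *)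
have gtau w n : (0 <= grid n (tau w) <= b + 1)%R.
  rewrite grid_ge0 /= (le_trans (ltW (grid_lt _ _)))// lerD//.
    by have /andP[] := tau0b w.
  by rewrite invf_le1// ler1n.
have mgrid n : measurable_fun [set: T] (fun w => M (grid n (tau w)) w).
  exact: measurable_grid_stopped.
have disc n : \int[P]_w (M (grid n (tau w)) w)%:E = \int[P]_w (M 0 w)%:E.
  transitivity (\int[P]_w (M (b + 1) w)%:E); last first.
    apply: martM => //; first by rewrite addr_ge0.
    exact: sigma_algebra_setT (sG 0%R (lexx _)).
  (* [A j] is known at time [j / n.+1], so on it the martingale property links the rounded time to
     the deterministic time [b + 1]. *)
  pose A j := [set w | grid_index n (tau w) = j].
  have GA j : G (j%:R / n.+1%:R)%R (A j).
    rewrite /A grid_index_preimage//; apply: sigma_algebra_setD.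
    - by apply: sG; rewrite divr_ge0.
    - by apply: Gtau; rewrite divr_ge0.
    - case: j => [|j]; first by have [] := sG (0%:R / n.+1%:R)%R _; rewrite ?divr_ge0.
      apply: (Gle (j%:R / n.+1%:R)%R); rewrite ?divr_ge0//.
        by rewrite ler_pM2r ?invr_gt0// ler_nat.
      by apply: Gtau; rewrite divr_ge0.
  have TA : setT = \bigcup_j A j.
    by apply/seteqP; split => // w _; exists (grid_index n (tau w)).
  have mA j : measurable (A j) by apply: Gm (GA j); rewrite divr_ge0.
  have tA : trivIset setT A by move=> i j _ _ [w [/= <- <-]].
  have mMb : measurable_fun [set: T] (fun w => (M (b + 1) w)%:E).
    by apply/measurable_EFinP; apply: mM; rewrite addr_ge0.
  rewrite TA ge0_integral_bigcup//; last 2 first.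
  - rewrite -TA; exact/measurable_EFinP.
  - by move=> w _; rewrite lee_fin.
  rewrite ge0_integral_bigcup//; last 2 first.
  - by rewrite -TA.
  - by move=> w _; rewrite lee_fin.
  apply: eq_eseriesr => j _.
  transitivity (\int[P]_(w in A j) (M (j%:R / n.+1%:R) w)%:E).
    by apply: eq_integral => w; rewrite inE /A /grid /= => ->.
  have [jb|jb] := leP (j%:R / n.+1%:R)%R (b + 1)%R.
    by apply/esym; apply: martM => //; rewrite divr_ge0.
  have -> : A j = set0.
    apply/seteqP; split => // w /= jw; move: jb.
    by rewrite ltNge -jw; have /andP[_ ->] := gtau w n.
  by rewrite !integral_set0.
have cvM : {ae P, forall w, setT w ->
    (M (grid n (tau w)) w)%:E @[n --> \oo] --> (M (tau w) w)%:E}.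
  apply: aeW => w _; apply/cvg_EFin; first exact: nearW.
  by apply: (continuous_paths_cvg (w := w) cM); [move=> n; exact: grid_ge0|exact: cvg_grid].
have domM : {ae P, forall w, forall n, setT w ->
    `|(M (grid n (tau w)) w)%:E| <= (EFin \o cst c) w}.
  by apply: aeW => w n _; rewrite /= ger0_norm// lee_fin Mc.
have [_ _] := dominated_convergence measurableT
  (fun n => (measurable_EFinP _ _).2 (mgrid n))
  ((measurable_EFinP _ _).2 (measurable_stopped cM mM mtau tau0))
  cvM (finite_measure_integrable_cst _ _ measurableT) domM.
rewrite /=; under eq_fun do rewrite disc.
by move=> /(cvg_unique (@ereal_hausdorff R) (cvg_cst _)).
Qed.

End optional_stopping.

Section bayes_quotient.
Context {R : realType}.
Implicit Types (e t x m : R).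

(* [Psi] in log-odds coordinates. *)
Definition psi x : R := x * (1 - expR x) / (1 + expR x).

Lemma psi_le0 x : psi x <= 0.
Proof.
rewrite pmulr_lle0 ?invr_gt0 ?addr_gt0 ?expR_gt0//.
have [x0|x0] := leP 0 x.
  by rewrite mulr_ge0_le0// subr_le0 -expR0 ler_expR.
by rewrite mulr_le0_ge0 ?ltW// subr_gt0 -expR0 ltr_expR.
Qed.

Lemma cvg_psi (U : Type) (FU : set_system U) {FF : Filter FU}
    (g : U -> R) (x : R) : g @ FU --> x -> psi (g u) @[u --> FU] --> psi x.
Proof.
move=> gx; apply: cvgM; first apply: cvgM => //.
  by apply: cvgB; [exact: cvg_cst|exact: cvg_expR].
apply: cvgV; first by rewrite gt_eqF// addr_gt0// expR_gt0.
by apply: cvgD; [exact: cvg_cst|exact: cvg_expR].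
Qed.

Lemma measurable_psi : measurable_fun [set: R] psi.
Proof. by apply: continuous_measurable_fun => x; apply: cvg_psi; exact: cvg_id. Qed.

Lemma Psi_logistic x : Psi (logistic x) = psi x.
Proof.
have e1 : 0 < 1 + expR x by rewrite addr_gt0// expR_gt0.
have ex := gt_eqF (expR_gt0 x); have e1' := gt_eqF e1.
rewrite /Psi /psi (_ : logistic x / (1 - logistic x) = expR x); last first.
  by rewrite /logistic; field; rewrite e1' /= addrK oner_eq0.
by rewrite expRK /logistic; field; rewrite e1'.
Qed.

Lemma logistic_logit (p : R) : 0 < p < 1 -> logistic (ln (p / (1 - p))) = p.
Proof.
move=> /andP[p0 p1]; have q0 : 0 < 1 - p by rewrite subr_gt0.
rewrite /logistic lnK ?posrE ?divr_gt0//; field.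
by rewrite subrK oner_eq0 gt_eqF.
Qed.

(** From [1 - u <= expR (- u)] follows [expR u <= 1 / (1 - u)], and [(1 + u + 2 u^2) (1 - u) = 1 +
    u^2 (1 - 2 u)] is at least 1. *)
Lemma expR_le_quadratic (u : R) : u <= 2^-1 -> expR u <= 1 + u + 2 * u ^+ 2.
Proof.
move=> u2; have u1 : 0 < 1 - u by lra.
have : 1 - u <= expR (- u) by have := expR_ge1Dx (- u).
rewrite expRN -(ler_pV2 _ _) ?inE ?unitfE ?invr_gt0 ?expR_gt0 ?gt_eqF ?invr_gt0
  ?expR_gt0//.
rewrite invrK => /le_trans; apply.
rewrite -[_^-1]mul1r ler_pdivrMr//.
have : 0 <= u ^+ 2 * (1 - 2 * u) by rewrite mulr_ge0 ?sqr_ge0//; lra.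
by lra.
Qed.

(* The difference quotient at [e = 0] of the sum of the martingales for [e] and
   [1 - e], which is [1] at [e = 0]. *)
Definition bayes_quotient m e t x : R :=
  e^-1 * (bayes_martingale m e t x + bayes_martingale m (1 - e) t x - 1).

(** With [q = 1 / (1 + expR x)] the two martingales sum to [q * expR u + (1 - q) * expR v], where
    [u = k t + e x] and [v = k t - e x]. As [k t = e (1 - e) m^2 t / 2] and [psi x = x (2 q - 1)],
    the linear terms give the limit up to [e m^2 t / 2]. The remainders are at most [2 (e K)^2],
    since [u] and [v] are bounded by [e K <= 1 / 2]. *)
Lemma bayes_quotient_bound m b c e t x : 0 < e -> 0 <= t <= b -> `|x| <= c ->
  e <= 1 -> e * (m ^+ 2 / 2 * b + c) <= 2^-1 ->
  `|bayes_quotient m e t x - (psi x + m ^+ 2 / 2 * t)| <=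
  e * (2 * (m ^+ 2 / 2 * b + c) ^+ 2 + m ^+ 2 / 2 * b).
Proof.
move=> e0 /andP[t0 tb] xc e1 eK; set K := m ^+ 2 / 2 * b + c in eK *.
have E0 : 0 < 1 + expR x by rewrite addr_gt0// expR_gt0.
pose k := m ^+ 2 * e * (1 - e) / 2.
pose u := k * t + e * x; pose v := k * t - e * x.
pose q := (1 + expR x)^-1.
have q0 : 0 < q by rewrite invr_gt0.
have q1 : q <= 1 by rewrite invf_le1// lerDl expR_ge0.
have m0 : 0 <= m ^+ 2 / 2 by rewrite divr_ge0// sqr_ge0.
have NE : bayes_martingale m e t x + bayes_martingale m (1 - e) t x =
    q * expR u + (1 - q) * expR v.
  rewrite /bayes_martingale -/q mulrC [X in _ + X]mulrC.
  congr (q * _ + _).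
  have -> : m ^+ 2 * (1 - e) * (1 - (1 - e)) / 2 * t + (1 - e) * x = v + x.
    by rewrite /v /k; field.
  have -> : 1 - q = expR x * q by rewrite /q; field; rewrite gt_eqF.
  by rewrite expRD; ring.
pose M := m ^+ 2 / 2 * t.
have M0 : 0 <= M by rewrite mulr_ge0.
have Mb : M <= m ^+ 2 / 2 * b by rewrite ler_wpM2l.
have ktE : k * t = e * (1 - e) * M by rewrite /k /M; field.
have kt0 : 0 <= k * t.
  by rewrite ktE; apply: mulr_ge0 => //; apply: mulr_ge0; rewrite ?subr_ge0// ltW.
have ktb : k * t <= e * (m ^+ 2 / 2 * b).
  rewrite ktE -mulrA ler_pM2l//; apply: le_trans Mb.
  by rewrite ler_piMl// gerBl ltW.
have /ler_normlP[xc1 xc2] := xc.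
have exc : - (e * c) <= e * x <= e * c.
  by rewrite -mulrN !ler_pM2l// -lerN2 opprK xc1 xc2.
have eKE : e * K = e * (m ^+ 2 / 2 * b) + e * c by rewrite /K mulrDr.
have uK : - (e * K) <= u <= e * K by rewrite eKE /u; lra.
have vK : - (e * K) <= v <= e * K by rewrite eKE /v; lra.
have rem y : - (e * K) <= y <= e * K ->
    exists2 r, expR y = 1 + y + r & 0 <= r <= 2 * (e * K) ^+ 2.
  move=> yK; exists (expR y - (1 + y)); first by rewrite addrC subrK.
  rewrite subr_ge0 expR_ge1Dx /= lerBlDr.
  apply: (le_trans (expR_le_quadratic _)); first by lra.
  rewrite addrC lerD2r ler_pM2l// -subr_ge0 subr_sqr mulr_ge0//; lra.
have [ru Eu /andP[ru0 ru1]] := rem _ uK; have [rv Ev /andP[rv0 rv1]] := rem _ vK.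
have -> : psi x = x * (2 * q - 1) by rewrite /psi /q; field; rewrite gt_eqF.
rewrite /bayes_quotient NE Eu Ev -/M.
have -> : e^-1 * (q * (1 + u + ru) + (1 - q) * (1 + v + rv) - 1) - (x * (2 * q - 1) + M) =
    e^-1 * (q * ru + (1 - q) * rv) - e * M.
  by rewrite /u /v ktE; field; rewrite gt_eqF.
have R0 : 0 <= q * ru + (1 - q) * rv.
  by rewrite addr_ge0// mulr_ge0// ?subr_ge0// ltW.
have R1 : q * ru + (1 - q) * rv <= 2 * (e * K) ^+ 2.
  have : q * ru <= q * (2 * (e * K) ^+ 2) by rewrite ler_pM2l.
  have : (1 - q) * rv <= (1 - q) * (2 * (e * K) ^+ 2).
    by rewrite ler_wpM2l// subr_ge0.
  by lra.
have eR0 : 0 <= e^-1 * (q * ru + (1 - q) * rv) by rewrite mulr_ge0// invr_ge0 ltW.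
have eR1 : e^-1 * (q * ru + (1 - q) * rv) <= e * (2 * K ^+ 2).
  by rewrite ler_pdivrMl//; apply: le_trans R1 _; rewrite exprMn; lra.
have eM0 : 0 <= e * M by rewrite mulr_ge0// ltW.
have eM1 : e * M <= e * (m ^+ 2 / 2 * b) by rewrite ler_pM2l.
by rewrite ler_norml; apply/andP; split; lra.
Qed.

Lemma psi_norm x : `|psi x| <= `|x|.
Proof.
have E0 : 0 < 1 + expR x by rewrite addr_gt0// expR_gt0.
rewrite /psi -mulrA normrM ler_piMr// normrM normfV (gtr0_norm E0) ler_pdivrMr//.
rewrite mul1r ler_norml; have := expR_gt0 x; lra.
Qed.

Lemma cvg_bayes_quotient m (e : nat -> R) t x : (forall n, 0 < e n <= 1) ->
  e @ \oo --> 0 -> 0 <= t ->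
  bayes_quotient m (e n) t x @[n --> \oo] --> psi x + m ^+ 2 / 2 * t.
Proof.
move=> e01 e0 t0; set y := psi x + _; set K := m ^+ 2 / 2 * t + `|x|.
set C := 2 * K ^+ 2 + m ^+ 2 / 2 * t.
have eK : \forall n \near \oo, e n * K <= 2^-1.
  have eK0 : e n * K @[n --> \oo] --> 0.
    by rewrite -(mul0r K); apply: cvgM => //; exact: cvg_cst.
  by apply: (cvgr_le _ eK0); rewrite invr_gt0.
apply: (@squeeze_cvgr _ _ _ _ (fun n => y - e n * C) (fun n => y + e n * C)).
- apply: filterS eK => n eKn; have /andP[en0 en1] := e01 n.
  have := @bayes_quotient_bound m t `|x| (e n) t x en0.
  by rewrite t0 !lexx => /(_ isT isT en1 eKn); rewrite ler_distl.
- rewrite -[X in _ --> X]subr0 -[in X in _ --> X](mul0r C).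
  by apply: cvgB; [exact: cvg_cst|apply: cvgM => //; exact: cvg_cst].
- rewrite -[X in _ --> X]addr0 -[in X in _ --> X](mul0r C).
  by apply: cvgD; [exact: cvg_cst|apply: cvgM => //; exact: cvg_cst].
Qed.

End bayes_quotient.

Lemma integral_probability_cst d (T : measurableType d) (R : realType)
    (P : probability T R) (r : \bar R) : (\int[P]_w r = r)%E.
Proof.
have /= -> := integral_cst P (@measurableT _ T) r.
by rewrite [X in (_ * X)%E]probability_setT mule1.
Qed.

Section stopped_posterior.
Local Open Scope ereal_scope.
Context {R : realType} {d : measure_display} {T : measurableType d}.
Variables (P : probability T R) (F : R -> set (set T)) (W : R -> T -> R).
Variables (theta : T -> R) (Z : R -> T -> R) (alpha sigma p : R).
Hypotheses (alpha0 : alpha != 0%R) (sigma0 : (0 < sigma)%R) (p01 : (0 < p < 1)%R).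
Hypothesis model : signal_model alpha sigma p P F W theta Z.

Local Notation m := (alpha / sigma)%R.
Local Notation l := (ln (p / (1 - p)))%R.
Local Notation phi := (log_odds W theta l m).

Let hF := model_filtration model.
Let hW := model_brownian model.
Let mtheta := model_theta_measurable model.
Let th01 := model_theta01 model.
Let indep := model_independent model.
Let odds := prior_odds p01 model.

Let mphi t : (0 <= t)%R -> measurable_fun [set: T] (phi t).
Proof. exact: (measurable_log_odds l m hF hW mtheta). Qed.

Let cphi : continuous_paths phi.
Proof. exact: (@continuous_log_odds _ _ _ _ _ _ _ _ _ _ p model). Qed.

Lemma filtration_log_odds : filtration (natural_filtration phi).
Proof.
split.
- by move=> t _; exact: smallest_sigma_algebra.
- by move=> t _; exact: natural_filtration_measurable.
- by move=> s t _; exact: natural_filtration_le.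
Qed.

Lemma natural_filtration_posterior t :
  natural_filtration Z t `<=` natural_filtration phi t.
Proof.
apply: sigma_process_min; first exact: smallest_sigma_algebra.
move=> s B /=; rewrite in_itv/= => /andP[s0 st] mB.
have [/(_ s s0)[ZX _ _] _ _] := model_posterior model.
apply: (natural_filtration_le st).
rewrite -natural_filtration_signal//.
by apply: ZX; exists B => //; rewrite setTI.
Qed.

Lemma log_odds0 w : phi 0 w = l.
Proof.
by rewrite /log_odds; case: hW => _ _ -> _ _; rewrite !mulr0 addr0 mulr0 addr0 subr0.
Qed.

Section bounded_time.
Variables (tau : T -> R) (b : R).
Hypothesis tau0b : forall w, (0 <= tau w <= b)%R.
Hypothesis Gtau : forall t, (0 <= t)%R ->
  natural_filtration phi t [set w | (tau w <= t)%R].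

Let tau0 w : (0 <= tau w)%R. Proof. by have /andP[] := tau0b w. Qed.

Let mtau : measurable_fun [set: T] tau.
Proof.
apply: measurable_of_le_preimage => // t t0.
by have [_ Gm _] := filtration_log_odds; exact: Gm (Gtau t0).
Qed.

Let mphitau : measurable_fun [set: T] (fun w => phi (tau w) w).
Proof. exact: measurable_stopped. Qed.

Lemma continuous_bayes_martingale_paths a :
  continuous_paths (fun t w => bayes_martingale m a t (phi t w)).
Proof.
move=> w; apply/subspace_continuousP => t t0; apply: cvg_bayes_martingale.
  exact: cvg_within.
by have /subspace_continuousP := @cphi w; exact.
Qed.

Lemma bayes_martingale_stopped a : (0 <= a <= 1)%R ->
  \int[P]_w (bayes_martingale m a (tau w) (phi (tau w) w))%:E =
  (bayes_martingale m a 0 l)%:E.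
Proof.
move=> a01.
rewrite (@optional_stopping _ _ _ P (natural_filtration phi)
  (fun t w => bayes_martingale m a t (phi t w)) _ _ _ _ _ tau b
  (expR (m ^+ 2 * a * (1 - a) / 2 * (b + 1))))//.
- under eq_integral do rewrite log_odds0.
  exact: integral_probability_cst.
- exact: filtration_log_odds.
- exact: continuous_bayes_martingale_paths.
- move=> t t0; apply: (measurableT_comp (measurable_bayes_martingale m a t)).
  exact: mphi.
- by move=> t w; exact: bayes_martingale_ge0.
- move=> s t A s0 st GA; exact: (bayes_martingaleP hF hW mtheta th01 indep odds).
- by move=> t w t0; exact: bayes_martingale_le.
Qed.

Lemma mean_stopped_logistic : \int[P]_w (logistic (phi (tau w) w))%:E = p%:E.
Proof.
rewrite -[in RHS](logistic_logit p01) -(bayes_martingale1 m 0).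
rewrite -bayes_martingale_stopped; last by rewrite ler01 lexx.
by apply: eq_integral => w _; rewrite bayes_martingale1.
Qed.

Lemma integrable_bayes_martingale_stopped a : (0 <= a <= 1)%R ->
  P.-integrable setT (fun w => (bayes_martingale m a (tau w) (phi (tau w) w))%:E).
Proof.
move=> a01; apply: measurable_bounded_integrable => //.
- by rewrite (le_lt_trans (probability_le1 _ _)) ?ltry.
- apply: (@measurable_stopped _ _ _ (fun t w => bayes_martingale m a t (phi t w))) => //.
    exact: continuous_bayes_martingale_paths.
  move=> t t0; apply: (measurableT_comp (measurable_bayes_martingale m a t)).
  exact: mphi.
exists (expR (m ^+ 2 * a * (1 - a) / 2 * b))%R; split => // x xb w _ /=.
rewrite ger0_norm ?bayes_martingale_ge0// (le_trans _ (ltW xb))//.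
exact: bayes_martingale_le.
Qed.

Lemma bayes_quotient_stopped e : (0 < e <= 1)%R ->
  \int[P]_w (bayes_quotient m e (tau w) (phi (tau w) w))%:E =
  (bayes_quotient m e 0 l)%:E.
Proof.
move=> /andP[e0 e1]; have e01 : (0 <= e <= 1)%R by rewrite ltW.
have e01' : (0 <= 1 - e <= 1)%R by rewrite subr_ge0 e1 gerBl ltW.
have i1 := integrable_bayes_martingale_stopped e01.
have i2 := integrable_bayes_martingale_stopped e01'.
have i0 := finite_measure_integrable_cst P 1 measurableT.
rewrite /bayes_quotient; under eq_integral do rewrite EFinM.
rewrite integralZl//; last first.
  under eq_fun do rewrite EFinB EFinD.
  by apply: integrableB => //; exact: integrableD.
under eq_integral do rewrite EFinB EFinD.
rewrite integralB//; last exact: integrableD.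
rewrite integralD// !bayes_martingale_stopped// integral_probability_cst.
by rewrite -!EFinD.
Qed.

Lemma mean_stopped_psi c : {ae P, forall w, (`|phi (tau w) w| <= c)%R} ->
  P.-integrable setT (EFin \o (fun w => psi (phi (tau w) w) + m ^+ 2 / 2 * tau w)%R) /\
  \int[P]_w (psi (phi (tau w) w) + m ^+ 2 / 2 * tau w)%:E = (psi l)%:E.
Proof.
have m0 : (0 <= m ^+ 2 / 2)%R by rewrite divr_ge0// sqr_ge0.
move=> phic; pose Y w := (psi (phi (tau w) w) + m ^+ 2 / 2 * tau w)%R.
(* The offset [n0] makes [e n * K <= 1 / 2] hold for every [n], so that one constant dominates all
   the quotients. *)
pose K := (m ^+ 2 / 2 * b + c)%R; pose n0 := Num.truncn K.
pose e n : R := ((2 * (n + n0).+1)%:R^-1)%R.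
have e01 n : (0 < e n <= 1)%R by rewrite invr_gt0 ltr0n /= invf_le1 ?ltr0n// ler1n.
have eK n : (e n * K <= 2^-1)%R.
  rewrite mulrC ler_pdivrMr ?ltr0n// natrM mulrA mulVf// mul1r.
  by rewrite (le_trans (ltW (truncnS_gt K)))// ler_nat ltnS leq_addl.
have ecvg : e @ \oo --> (0 : R)%R.
  apply: (@squeeze_cvgr _ _ _ _ (cst 0%R) (fun n => n.+1%:R^-1)%R).
  - apply: nearW => n; have /andP[/ltW -> _] := e01 n.
    rewrite /= lef_pV2 ?posrE ?ltr0n// ler_nat.
    by rewrite mul2n -addnn addSn ltnS (leq_trans (leq_addr n0 n))// leq_addr.
  - exact: cvg_cst.
  - exact: cvg_harmonic.
have mY : measurable_fun setT Y.
  apply: measurable_funD; first exact: (measurableT_comp measurable_psi).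
  exact: measurable_funM.
pose f n w := bayes_quotient m (e n) (tau w) (phi (tau w) w).
have mf n : measurable_fun setT (f n).
  have mbm a : (0 <= a <= 1)%R -> measurable_fun setT
      (fun w => bayes_martingale m a (tau w) (phi (tau w) w)).
    move=> a01; apply/measurable_EFinP.
    exact: measurable_int (integrable_bayes_martingale_stopped a01).
  have /andP[/ltW en0 en1] := e01 n.
  apply: measurable_funM => //; apply: measurable_funB => //.
  by apply: measurable_funD; apply: mbm; rewrite ?en0 ?en1// subr_ge0 en1 gerBl.
have fY : {ae P, forall w, setT w -> (f n w)%:E @[n --> \oo] --> (Y w)%:E}.
  apply: aeW => w _; apply/cvg_EFin; first exact: nearW.
  exact: cvg_bayes_quotient.
(* The error of the quotient, with [e n <= 1], plus a bound on the limit [Y]. *)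
pose C := (2 * K ^+ 2 + m ^+ 2 / 2 * b + (c + m ^+ 2 / 2 * b))%R.
have domf : {ae P, forall w, forall n, setT w -> `|(f n w)%:E| <= (EFin \o cst C) w}.
  apply: filterS phic => w pc n _; rewrite /= lee_fin.
  have /andP[en0 en1] := e01 n; have /andP[t0 tb] := tau0b w.
  have := @bayes_quotient_bound R m b c (e n) (tau w) _ en0 (tau0b w) pc en1 (eK n).
  rewrite -/(f n w) -/(Y w) => fYw.
  rewrite -(subrK (Y w) (f n w)) (le_trans (ler_normD _ _))// lerD//.
    apply: le_trans fYw _; rewrite ler_piMl//.
    by apply: addr_ge0; apply: mulr_ge0 => //; [exact: sqr_ge0|exact: le_trans tb].
  rewrite (le_trans (ler_normD _ _))// lerD//; first exact: le_trans (psi_norm _) pc.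
  by rewrite ger0_norm ?ler_wpM2l// mulr_ge0.
have [iY _] := dominated_convergence measurableT
  (fun n => (measurable_EFinP _ _).2 (mf n)) ((measurable_EFinP _ _).2 mY)
  fY (finite_measure_integrable_cst _ _ measurableT) domf.
rewrite /= => cv; split; first exact: iY.
have cv' : \int[P]_w (f n w)%:E @[n --> \oo] --> (psi l)%:E.
  under eq_fun do rewrite bayes_quotient_stopped//.
  apply/cvg_EFin; first exact: nearW.
  rewrite -[X in _ --> X]addr0 -[in X in _ --> X](mulr0 (m ^+ 2 / 2)%R).
  exact: cvg_bayes_quotient.
exact: (cvg_unique (@ereal_hausdorff R) cv cv').
Qed.

End bounded_time.
End stopped_posterior.

(** * Stopping times of the posterior *)

Section exit_time.
Context {R : realType} {d : measure_display} {T : measurableType d}.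
Variables (Z : R -> T -> R) (x y : R).
Hypothesis cZ : continuous_paths Z.

Definition outside_times (w : T) : set R := [set t | 0 <= t /\ ~~ (x < Z t w < y)].

(** The empty set has its own case because a real [inf] would give it a finite default value. *)
Definition exit_time (w : T) : \bar R :=
  if pselect (outside_times w !=set0) then (inf (outside_times w))%:E else +oo%E.

Lemma path_bounds (w : T) (t : R) : 0 <= t -> exists s1 s2 : R,
  [/\ 0 <= s1, 0 <= s2 & forall s, 0 <= s <= t -> Z s1 w <= Z s w <= Z s2 w] /\
  (s1 <= t /\ s2 <= t).
Proof.
move=> t0; have cZt : {within `[0, t], continuous (Z ^~ w)}.
  have sub : `[0, t]%classic `<=` (`[0, +oo[%classic : set R).
    by move=> s /=; rewrite !in_itv/= => /andP[->].
  exact: (continuous_subspaceW sub (@cZ w)).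
have [s1 s1t H1] := EVT_min t0 cZt; have [s2 s2t H2] := EVT_max t0 cZt.
move: s1t s2t; rewrite !in_itv/= => /andP[s10 s1t] /andP[s20 s2t].
exists s1, s2; split => //; split => // s st.
by rewrite H1 ?H2 ?in_itv.
Qed.

Let outside_has_inf w : outside_times w !=set0 -> has_inf (outside_times w).
Proof. by move=> S0; split => //; exists 0 => s [s0 _]. Qed.

Let outside_inf_ge0 w : outside_times w !=set0 -> 0 <= inf (outside_times w).
Proof. by move=> S0; apply: lb_le_inf => // s [s0 _]. Qed.

Lemma exit_time_ge0 w : (0 <= exit_time w)%E.
Proof.
rewrite /exit_time; case: pselect => S0; last exact: leey.
by rewrite lee_fin outside_inf_ge0.
Qed.

Lemma inside_before_exit w t : 0 <= t -> (t%:E < exit_time w)%E -> x < Z t w < y.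
Proof.
move=> t0; rewrite /exit_time; case: pselect => S0; last first.
  by move=> _; apply: contrapT => /negP H; apply: S0; exists t.
rewrite lte_fin => tS; apply: contrapT => /negP H.
have : inf (outside_times w) <= t by apply: ge_inf => //; exists 0 => s [].
by rewrite leNgt tS.
Qed.

(** The infimum is attained: were the path inside at [t], it would by continuity be inside at late
    members of a sequence of outside times converging to [t]. *)
Lemma outside_at_exit w t : exit_time w = t%:E -> ~~ (x < Z t w < y).
Proof.
rewrite /exit_time; case: pselect => // S0 [tE]; apply/negP => /andP[xZ Zy].
have near_inf (n : nat) : exists s, outside_times w s /\ s < t + n.+1%:R^-1.
  have n0 : 0 < n.+1%:R^-1 :> R by rewrite invr_gt0.
  by have [s Ss st] := inf_adherent n0 (outside_has_inf S0); exists s; rewrite -tE.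
have [u uP] := choice near_inf.
have ut n : t <= u n.
  by rewrite -tE; apply: ge_inf; [exists 0 => s []|have [] := uP n].
have cu : u @ \oo --> t.
  apply: (@squeeze_cvgr _ _ _ _ (cst t) (fun n => t + n.+1%:R^-1)).
  - by apply: nearW => n; rewrite ut /= ltW//; have [] := uP n.
  - exact: cvg_cst.
  - by rewrite -[X in _ --> X]addr0; apply: cvgD; [exact: cvg_cst|exact: cvg_harmonic].
have u0 n : 0 <= u n by have [[]] := uP n.
have cZu := continuous_paths_cvg (w := w) cZ u0 cu.
have [n _ /(_ n (leqnn _)) nP] : \forall n \near \oo, x < Z (u n) w < y.
  by apply: filterS2 (cvgr_gt _ cZu _ xZ) (cvgr_lt _ cZu _ Zy) => n -> ->.
by have [[_]] := uP n; rewrite nP.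
Qed.

Lemma exit_time_leP w t : 0 <= t ->
  (exit_time w <= t%:E)%E <-> ~ (forall s, 0 <= s <= t -> x < Z s w < y).
Proof.
move=> t0; split => [et H|H].
  have efin : exit_time w \is a fin_num.
    by rewrite ge0_fin_numE ?exit_time_ge0// (le_lt_trans et) ?ltry.
  have := outside_at_exit (esym (fineK efin)); rewrite H//.
  by rewrite fine_ge0 ?exit_time_ge0//= -lee_fin fineK.
rewrite leNgt; apply/negP => te; apply: H => s /andP[s0 st].
by apply: inside_before_exit => //; apply: le_lt_trans te; rewrite lee_fin.
Qed.

(** Staying in the open interval up to [t] is a countable condition: by compactness the path keeps
    some margin [1 / k.+1], and a margin at the grid times persists by continuity. *)
Lemma exit_time_event (t : R) : 0 <= t ->
  natural_filtration Z t [set w | (exit_time w <= t%:E)%E].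
Proof.
move=> t0.
have -> : [set w | (exit_time w <= t%:E)%E] = ~` 
    [set w | forall s, 0 <= s <= t -> x < Z s w < y].
  by apply/seteqP; split => w /= /(exit_time_leP w t0).
apply: sigma_processC.
(* The cap at [t] is needed because grid times approach [s <= t] from above and could leave
   [[0, t]]. *)
pose q (n i : nat) : R := Num.min t (i%:R / n.+1%:R).
have q0 n i : 0 <= q n i by rewrite le_min t0 divr_ge0.
have qt n i : q n i <= t by rewrite ge_min lexx.
rewrite (_ : [set w | _] = \bigcup_k \bigcap_n \bigcap_i
    (Z (q n i) @^-1` `[x + k.+1%:R^-1, y - k.+1%:R^-1])).
  apply: sigma_process_bigcup => k.
  rewrite -[X in sigma_process _ _ X]setCK; apply: sigma_processC.
  rewrite setC_bigcap; apply: sigma_process_bigcup => n.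
  rewrite setC_bigcap; apply: sigma_process_bigcup => i.
  apply: sigma_processC; apply: sigma_process_preimage => //.
  by rewrite /= in_itv/= q0 qt.
apply/seteqP; split => w /=.
  move=> H; have [s1 [s2 [[s10 s20 sb] [s1t s2t]]]] := path_bounds w t0.
  have /andP[xs1 _] := H s1 (introT andP (conj s10 s1t)).
  have /andP[_ s2y] := H s2 (introT andP (conj s20 s2t)).
  pose e := Num.min (Z s1 w - x) (y - Z s2 w).
  have e0 : 0 < e by rewrite lt_min !subr_gt0 xs1.
  exists (Num.truncn e^-1) => // n _ i _ /=.
  have ke : (Num.truncn e^-1).+1%:R^-1 <= e.
    by rewrite invf_ple ?posrE// ltW// truncnS_gt.
  have /andP[h1 h2] := sb (q n i) (introT andP (conj (q0 n i) (qt n i))).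
  move: ke; rewrite le_min in_itv/=; move: (_.+1%:R^-1) => a /andP[k1 k2].
  by apply/andP; split; lra.
move=> [k _ H] s /andP[s0 st].
have cq : Z (q n (grid_index n s)) w @[n --> \oo] --> Z s w.
  apply: (continuous_paths_cvg (w := w) cZ) => //.
  apply: (@squeeze_cvgr _ _ _ _ (cst s) (fun n => grid n s)).
  - by apply: nearW => n; rewrite /q -/(grid n s) le_min st grid_ge//= ge_min lexx orbT.
  - exact: cvg_cst.
  - exact: cvg_grid.
have k0 : 0 < k.+1%:R^-1 :> R by rewrite invr_gt0.
have b n : x + k.+1%:R^-1 <= Z (q n (grid_index n s)) w <= y - k.+1%:R^-1.
  by have := H n I (grid_index n s) I; rewrite /= in_itv.
apply/andP; split.
  apply: (@lt_le_trans _ _ (x + k.+1%:R^-1)); first by rewrite ltrDl.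
  by apply: (cvgr_to_ge cq); apply: nearW => n; have /andP[] := b n.
apply: (@le_lt_trans _ _ (y - k.+1%:R^-1)); last by rewrite ltrBlDr ltrDl.
by apply: (cvgr_to_le cq); apply: nearW => n; have /andP[] := b n.
Qed.

Lemma exit_time_stopping : stopping_time (natural_filtration Z) exit_time.
Proof. by split; [exact: exit_time_ge0|exact: exit_time_event]. Qed.

(** The value at the exit time is a limit of inside values, hence the closed interval. Time 0 has no
    earlier times and uses the hypothesis on [Z 0]. *)
Lemma inside_up_to_exit w (t : R) : x < Z 0 w < y -> 0 <= t ->
  (t%:E <= exit_time w)%E -> x <= Z t w <= y.
Proof.
move=> Z0; rewrite le_eqVlt => /orP[/eqP <- _|t0 te].
  by have /andP[/ltW -> /ltW ->] := Z0.
pose u n := t * (1 - n.+1%:R^-1).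
have u0 n : 0 <= u n by rewrite mulr_ge0 ?(ltW t0)// subr_ge0 invf_le1// ler1n.
have cu : u @ \oo --> t.
  rewrite -[X in _ --> X]mulr1 -[in X in _ --> X](subr0 1).
  by apply: cvgM; [exact: cvg_cst|apply: cvgB; [exact: cvg_cst|exact: cvg_harmonic]].
have cZu := continuous_paths_cvg (w := w) cZ u0 cu.
have b n : x < Z (u n) w < y.
  apply: inside_before_exit => //; apply: lt_le_trans te; rewrite lte_fin.
  by rewrite /u mulrBr mulr1 ltrBlDr ltrDl mulr_gt0 ?invr_gt0.
apply/andP; split.
  by apply: (cvgr_to_ge cZu); apply: nearW => n; have /andP[/ltW] := b n.
by apply: (cvgr_to_le cZu); apply: nearW => n; have /andP[_ /ltW] := b n.
Qed.

End exit_time.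

Section fatou_limit.
Local Open Scope ereal_scope.
Context d (T : measurableType d) (R : realType) (mu : {measure set T -> \bar R}).

Lemma fatou_limit (f : (T -> \bar R)^nat) (f' : T -> \bar R) (B : nat -> \bar R) b :
  (forall n, measurable_fun [set: T] (f n)) -> measurable_fun [set: T] f' ->
  (forall n x, 0 <= f n x) -> (forall x, 0 <= f' x) ->
  {ae mu, forall x, f n x @[n --> \oo] --> f' x} ->
  (forall n, \int[mu]_x f n x <= B n) -> B @ \oo --> b ->
  \int[mu]_x f' x <= b.
Proof.
move=> mf mf' f0 f'0 ff' fB Bb.
have lim_ge0 x : 0 <= limn_einf (f ^~ x).
  rewrite limn_einf_lim; apply: lime_ge; first exact: is_cvg_einfs.
  by apply: nearW => n; apply/ereal_infP => _ [k _ <-].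
rewrite (@ge0_ae_eq_integral _ _ _ mu setT f' (fun x => limn_einf (f ^~ x)))//.
- apply: (le_trans (fatou mu measurableT mf (fun n x _ => f0 n x))).
  rewrite limn_einf_lim -(cvg_lim (@ereal_hausdorff R) Bb).
  apply: lee_lim; [exact: is_cvg_einfs|exact: cvgP Bb|].
  apply: nearW => n; apply: le_trans (fB n).
  by apply: ereal_inf_lbound; exists n => /=.
- apply: (emeasurable_fun_cvg (fun n x => einfs (f ^~ x) n)).
    exact: measurable_fun_einfs.
  by move=> x _; rewrite limn_einf_lim; exact: is_cvg_einfs.
- by apply: filterS ff' => x fx _; have [->] := cvg_limn_einf_sup fx.
Qed.

End fatou_limit.

Section stopping_time_operations.
Context {R : realType} {d : measure_display} {T : measurableType d}.
Implicit Types (tau rho : T -> \bar R) (Z : R -> T -> R) (G : R -> set (set T)).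

Lemma stopping_time_min G tau rho : filtration G ->
  stopping_time G tau -> stopping_time G rho ->
  stopping_time G (fun w => Order.min (tau w) (rho w)).
Proof.
move=> [sG _ _] [tau0 Gtau] [rho0 Grho]; split.
  by move=> w; rewrite le_min tau0 rho0.
move=> t t0; rewrite (_ : [set w | _] =
  [set w | (tau w <= t%:E)%E] `|` [set w | (rho w <= t%:E)%E]).
  by apply: sigma_algebra_setU; [exact: sG|exact: Gtau|exact: Grho].
by apply/seteqP; split => w /=; rewrite ge_min => /orP.
Qed.

Lemma stopping_time_sub G G' tau : (forall t, 0 <= t -> G t `<=` G' t) ->
  stopping_time G tau -> stopping_time G' tau.
Proof. by move=> GG' [tau0 Gtau]; split => // t t0; exact: GG' (Gtau t t0). Qed.

Definition truncated tau (b : R) (w : T) : R := fine (Order.min (tau w) b%:E).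

Lemma truncatedE tau b w : (0 <= tau w)%E -> 0 <= b ->
  (truncated tau b w)%:E = Order.min (tau w) b%:E.
Proof.
move=> tau0 b0; rewrite /truncated fineK// ge0_fin_numE.
  by rewrite (@le_lt_trans _ _ b%:E) ?ltry// ge_min lexx orbT.
by rewrite le_min tau0 lee_fin.
Qed.

Lemma truncated_bounds tau b w : (0 <= tau w)%E -> 0 <= b ->
  0 <= truncated tau b w <= b.
Proof.
move=> tau0 b0; rewrite -!lee_fin truncatedE// le_min tau0 lee_fin b0 /=.
by rewrite ge_min lexx orbT.
Qed.

Lemma truncated_le tau b w : (0 <= tau w)%E -> 0 <= b ->
  ((truncated tau b w)%:E <= tau w)%E.
Proof. by move=> tau0 b0; rewrite truncatedE// ge_min lexx. Qed.

Lemma truncated_id tau b w : (0 <= tau w)%E -> (tau w <= b%:E)%E ->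
  truncated tau b w = fine (tau w).
Proof. by move=> tau0 taub; rewrite /truncated min_l. Qed.

Lemma truncated_event G tau b : filtration G -> stopping_time G tau -> 0 <= b ->
  forall t, 0 <= t -> G t [set w | truncated tau b w <= t].
Proof.
move=> [sG _ _] [tau0 Gtau] b0 t t0; have [bt|tb] := leP b t.
  rewrite (_ : [set w | _] = setT); first exact: sigma_algebra_setT (sG t t0).
  apply/seteqP; split => // w _ /=.
  by apply: le_trans bt; have /andP[] := truncated_bounds (tau0 w) b0.
rewrite (_ : [set w | _] = [set w | (tau w <= t%:E)%E]); first exact: Gtau.
apply/seteqP; split => w /=; rewrite -lee_fin truncatedE// ge_min => //.
  by move=> /orP[//|]; rewrite lee_fin leNgt tb.
by move=> ->.
Qed.

Lemma measurable_stopping_time G tau : filtration G -> stopping_time G tau ->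
  measurable_fun [set: T] tau.
Proof.
move=> [_ Gm _] [tau0 Gtau].
apply: (measurability (@ErealGenOInfty.G R)) => [|/= _ [_] [r] -> <-].
  exact: ErealGenOInfty.measurableE.
rewrite setTI (_ : _ @^-1` _ = ~` [set w | (tau w <= r%:E)%E]); last first.
  by apply/seteqP; split => w /=; rewrite in_itv/= andbT ltNge => /negP.
apply: measurableC; have [r0|r0] := leP 0 r; first exact: Gm (Gtau r r0).
rewrite (_ : [set w | _] = set0)//; apply/seteqP; split => // w /=.
by rewrite leNgt (lt_le_trans _ (tau0 w)) ?lte_fin.
Qed.

Lemma cvg_truncated tau w : (0 <= tau w)%E -> (tau w < +oo)%E ->
  \forall n \near \oo, truncated tau n%:R w = fine (tau w).
Proof.
move=> tau0 tauoo; have fin : tau w \is a fin_num by rewrite ge0_fin_numE.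
exists (Num.truncn (fine (tau w))).+1 => // n /= kn; apply: truncated_id => //.
by rewrite -[leLHS](fineK fin) lee_fin (le_trans (ltW (truncnS_gt _)))// ler_nat.
Qed.

End stopping_time_operations.

Section posterior_stopping.
Local Open Scope ereal_scope.
Context {R : realType} {d : measure_display} {T : measurableType d}.
Variables (P : probability T R) (F : R -> set (set T)) (W : R -> T -> R).
Variables (theta : T -> R) (Z : R -> T -> R) (alpha sigma p : R).
Hypotheses (alpha0 : alpha != 0%R) (sigma0 : (0 < sigma)%R) (p01 : (0 < p < 1)%R).
Hypothesis model : signal_model alpha sigma p P F W theta Z.

Local Notation m := (alpha / sigma)%R.
Local Notation logit := (fun x => ln (x / (1 - x)))%R.
Local Notation l := (ln (p / (1 - p)))%R.
Local Notation phi := (log_odds W theta l m).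
Local Notation G := (natural_filtration phi).

Let mphi t : (0 <= t)%R -> measurable_fun [set: T] (phi t).
Proof.
exact: (measurable_log_odds l m (model_filtration model) (model_brownian model)
  (model_theta_measurable model)).
Qed.

Let cphi : continuous_paths phi.
Proof. exact: (@continuous_log_odds _ _ _ _ _ _ _ _ _ _ p model). Qed.

Let cZ : continuous_paths Z. Proof. by have [] := model_posterior model. Qed.

Let hG : filtration G. Proof. exact: (filtration_log_odds model). Qed.

Let m2 : (0 < m ^+ 2 / 2)%R.
Proof. by rewrite divr_gt0// exprn_even_gt0//= mulf_neq0// invr_eq0 gt_eqF. Qed.

Let posterior_ae := posterior_logistic alpha0 sigma0 p01 model.

Lemma posterior_ge0_le1 t w : (0 <= t)%R -> (0 <= Z t w <= 1)%R.
Proof. by have [_ H _] := model_posterior model; exact: H. Qed.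

Lemma measurable_posterior t : (0 <= t)%R -> measurable_fun [set: T] (Z t).
Proof.
move=> t0 _ B mB; have [/(_ t t0)[ZX _ _] _ _] := model_posterior model.
have [_ Gm _] := hG; apply: (Gm t t0).
by rewrite -natural_filtration_signal//; apply: ZX; exists B.
Qed.

Lemma posterior_initial : {ae P, forall w, Z 0 w = p}.
Proof.
apply: filterS posterior_ae => w /(_ _ (lexx _)) ->.
by rewrite (log_odds0 model) logistic_logit.
Qed.

Lemma logit_le (x y : R) : (0 < x)%R -> (x <= y)%R -> (y < 1)%R -> (logit x <= logit y)%R.
Proof.
move=> x0 xy y1; have y0 := lt_le_trans x0 xy; have x1 := le_lt_trans xy y1.
rewrite ler_ln ?posrE ?divr_gt0 ?subr_gt0//.
rewrite ler_pdivrMr ?subr_gt0// mulrAC ler_pdivlMr ?subr_gt0//; lra.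
Qed.

Lemma logit_logistic (u : R) : logit (logistic u) = u.
Proof.
have e1 : (0 < 1 + expR u)%R by rewrite addr_gt0// expR_gt0.
rewrite (_ : logistic u / (1 - logistic u) = expR u)%R ?expRK//.
by rewrite /logistic; field; rewrite (gt_eqF e1) /= addrK oner_eq0.
Qed.

Lemma logistic_bound (x y u : R) : (0 < x)%R -> (y < 1)%R ->
  (x <= logistic u <= y)%R -> (`|u| <= `|logit x| + `|logit y|)%R.
Proof.
move=> x0 y1 /andP[xu uy].
have := logit_le x0 xu (logistic_lt1 u); rewrite logit_logistic => h1.
have := logit_le (logistic_gt0 u) uy y1; rewrite logit_logistic => h2.
rewrite ler_norml; apply/andP; split.
  by have := ler_norm (- logit x)%R; rewrite normrN; have := normr_ge0 (logit y); lra.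
by have := ler_norm (logit y); have := normr_ge0 (logit x); lra.
Qed.

Lemma posterior_stopping_time tau : stopping_time (natural_filtration Z) tau ->
  stopping_time G tau.
Proof.
by apply: stopping_time_sub => t _; exact: (natural_filtration_posterior alpha0 sigma0 model).
Qed.

(** [mean_stopped_psi] rearranged so that both integrands are nonnegative, the form in which Fatou's
    lemma applies. The bounds [x] and [y] on the posterior bound the log-odds. *)
Lemma stopped_time_identity tau (b x y : R) : stopping_time G tau -> (0 <= b)%R ->
  (0 < x)%R -> (y < 1)%R ->
  {ae P, forall w, (x <= Z (truncated tau b w) w <= y)%R} ->
  \int[P]_w (m ^+ 2 / 2 * truncated tau b w)%:E =
  (psi l)%:E + \int[P]_w (- psi (phi (truncated tau b w) w))%:E.
Proof.
move=> Gtau b0 x0 y1 Zxy; have [tau0 _] := Gtau.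
have s0b w := truncated_bounds (tau0 w) b0.
have Gs := truncated_event hG Gtau b0.
have phic : {ae P, forall w, (`|phi (truncated tau b w) w| <= `|logit x| + `|logit y|)%R}.
  apply: filterS2 Zxy posterior_ae => w + Zw; have /andP[s0 _] := s0b w.
  by rewrite Zw//; exact: logistic_bound.
have [iY IY] := mean_stopped_psi p01 model s0b Gs phic.
have ms : measurable_fun [set: T] (truncated tau b).
  apply: measurable_of_le_preimage => [w|t t0]; first by have /andP[] := s0b w.
  by have [_ Gm _] := hG; exact: Gm (Gs t t0).
have iS : P.-integrable setT (fun w => (m ^+ 2 / 2 * truncated tau b w)%:E).
  apply: measurable_bounded_integrable => //.
  - by rewrite (le_lt_trans (probability_le1 _ _)) ?ltry.
  - exact: measurable_funM.
  exists (m ^+ 2 / 2 * b)%R; split; [exact: num_real|move=> z zb w _ /=].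
  have /andP[s0 sb] := s0b w; apply: le_trans (ltW zb).
  by rewrite ger0_norm ?ler_pM2l// mulr_ge0// ltW.
under [X in _ + X]eq_integral => w _.
  rewrite (_ : - psi _ = m ^+ 2 / 2 * truncated tau b w -
    (psi (phi (truncated tau b w) w) + m ^+ 2 / 2 * truncated tau b w))%R; last by ring.
  rewrite EFinB; over.
by rewrite integralB// IY [RHS]addeC subeK.
Qed.

Section finite_time.
Variable tau : T -> \bar R.
Hypothesis Ztau : stopping_time (natural_filtration Z) tau.
Hypothesis tau_fin : {ae P, forall w, tau w < +oo}.

Let Gtau := posterior_stopping_time Ztau.
Let tau0 w : 0 <= tau w. Proof. by have [] := Ztau. Qed.
Let ftau0 w : (0 <= fine (tau w))%R. Proof. exact: fine_ge0. Qed.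

Let mtau : measurable_fun [set: T] tau.
Proof. exact: measurable_stopping_time Gtau. Qed.

Let mftau : measurable_fun [set: T] (fun w => fine (tau w)).
Proof. exact: measurableT_comp. Qed.

Lemma measurable_stopped_posterior : measurable_fun [set: T] (stopped Z tau).
Proof. exact: (measurable_stopped cZ measurable_posterior). Qed.

Let mphitau : measurable_fun [set: T] (fun w => phi (fine (tau w)) w).
Proof. exact: (measurable_stopped cphi mphi). Qed.

Lemma stopped_posterior_ae :
  {ae P, forall w, stopped Z tau w = logistic (phi (fine (tau w)) w)}.
Proof. by apply: filterS posterior_ae => w Zw; rewrite /stopped Zw. Qed.

Lemma mean_stopped_posterior : \int[P]_w (stopped Z tau w)%:E = p%:E.
Proof.
rewrite (@ae_eq_integral _ _ _ P setT (fun w => (logistic (phi (fine (tau w)) w))%:E))//.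
- pose s n := truncated tau n%:R.
  have s0b n w : (0 <= s n w <= n%:R)%R by apply: truncated_bounds.
  have Gs n := truncated_event hG Gtau (ler0n R n).
  have ms n : measurable_fun setT (s n).
    apply: measurable_of_le_preimage => [w|t t0]; first by have /andP[] := s0b n w.
    by have [_ Gm _] := hG; exact: Gm (Gs n t t0).
  have mf n : measurable_fun setT (fun w => (logistic (phi (s n w) w))%:E).
    apply/measurable_EFinP; apply: (measurableT_comp measurable_logistic).
    by apply: (measurable_stopped cphi mphi) => // w; have /andP[] := s0b n w.
  have mf' : measurable_fun setT (fun w => (logistic (phi (fine (tau w)) w))%:E).
    by apply/measurable_EFinP; apply: (measurableT_comp measurable_logistic).
  have cv : {ae P, forall w, setT w -> (logistic (phi (s n w) w))%:E @[n --> \oo] -->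
      (logistic (phi (fine (tau w)) w))%:E}.
    apply: filterS tau_fin => w tw _; apply: cvg_near_cst.
    by apply: filterS (cvg_truncated (tau0 w) tw) => n; rewrite /s => ->.
  have dom : {ae P, forall w, forall n, setT w ->
      `|(logistic (phi (s n w) w))%:E| <= (EFin \o cst 1%R) w}.
    apply: aeW => w n _; rewrite /= lee_fin ger0_norm ?(ltW (logistic_gt0 _))//.
    exact: ltW (logistic_lt1 _).
  have [_ _] := dominated_convergence measurableT mf mf' cv
    (finite_measure_integrable_cst _ _ measurableT) dom.
  rewrite /=; under eq_fun do rewrite (mean_stopped_logistic p01 model (s0b _) (Gs _)).
  by move=> /(cvg_unique (@ereal_hausdorff R) (cvg_cst _)).
- by apply/measurable_EFinP; exact: measurable_stopped_posterior.
- by apply/measurable_EFinP; apply: (measurableT_comp measurable_logistic).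
- by apply: filterS stopped_posterior_ae => w ->.
Qed.

(** The identity is used at [tau] truncated by [n] and by the exit from an interval growing to
    [(0, 1)]. A path on [[0, tau]] has its extrema strictly inside [(0, 1)], so the truncations
    eventually equal [tau]; as [- psi] is unbounded, Fatou's lemma keeps only an inequality. *)
Lemma neg_psi_stopped_posterior :
  \int[P]_w (- psi (phi (fine (tau w)) w))%:E <=
  - (psi l)%:E + \int[P]_w ((m ^+ 2 / 2)%:E * tau w).
Proof.
have /andP[p0 p1] := p01.
have ep n : (0 < (n.+1%:R^-1 : R) <= 1)%R by rewrite invr_gt0 ltr0n /= invf_le1// ler1n.
(* The halves keep the prior strictly inside the interval already for [n = 0]. *)
pose x n : R := (p / 2 * n.+1%:R^-1)%R; pose y n : R := (1 - (1 - p) / 2 * n.+1%:R^-1)%R.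
have q0 : (0 < (1 - p) / 2)%R by rewrite divr_gt0// subr_gt0.
have h0 : (0 < p / 2)%R by rewrite divr_gt0.
have x0 n : (0 < x n)%R by rewrite mulr_gt0//; have /andP[] := ep n.
have xp n : (x n < p)%R.
  have /andP[_ e1] := ep n; rewrite (@le_lt_trans _ _ (p / 2)%R)//; last lra.
  by rewrite ler_piMr// ltW.
have y1 n : (y n < 1)%R.
  by rewrite ltrBlDr ltrDl mulr_gt0//; have /andP[] := ep n.
have py n : (p < y n)%R.
  have /andP[_ e1] := ep n; rewrite (@lt_le_trans _ _ (1 - (1 - p) / 2)%R)//; first lra.
  by rewrite lerB// ler_piMr// ltW.
pose rho n w := Order.min (tau w) (exit_time Z (x n) (y n) w).
have Zrho n : stopping_time (natural_filtration Z) (rho n).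
  apply: stopping_time_min => //; last exact: exit_time_stopping.
  split.
  - by move=> t _; exact: smallest_sigma_algebra.
  - by move=> t _; apply: natural_filtration_measurable; exact: measurable_posterior.
  - by move=> s t _; exact: natural_filtration_le.
have Grho n := posterior_stopping_time (Zrho n).
have rho0 n w : 0 <= rho n w by have [] := Zrho n.
pose s n := truncated (rho n) n%:R.
have s0b n w : (0 <= s n w <= n%:R)%R by apply: truncated_bounds.
have ms n : measurable_fun setT (s n).
  apply: measurable_of_le_preimage => [w|t t0]; first by have /andP[] := s0b n w.
  by have [_ Gm _] := hG; apply: (Gm t t0); exact: (truncated_event hG (Grho n) _ t0).
have Zs n : {ae P, forall w, (x n <= Z (s n w) w <= y n)%R}.
  apply: filterS posterior_initial => w Z0; have /andP[s0 _] := s0b n w.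
  apply: (inside_up_to_exit cZ); rewrite ?Z0 ?xp ?py//.
  apply: (le_trans (truncated_le (rho0 n w) (ler0n _ _))).
  by rewrite ge_min lexx orbT.
have Is n := stopped_time_identity (Grho n) (ler0n R n) (x0 n) (y1 n) (Zs n).
have mpsi (h : T -> R) : measurable_fun setT h ->
    measurable_fun setT (fun w => (- psi (h w))%:E).
  move=> mh; apply/measurable_EFinP; apply: measurableT_comp => //.
  exact: (measurableT_comp measurable_psi).
apply: (@fatou_limit _ _ _ P (fun n w => (- psi (phi (s n w) w))%:E)
  (fun w => (- psi (phi (fine (tau w)) w))%:E)
  (fun=> - (psi l)%:E + \int[P]_w ((m ^+ 2 / 2)%:E * tau w))).
- move=> n; apply: mpsi; apply: (measurable_stopped cphi mphi) => // w.
  by have /andP[] := s0b n w.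
- exact: mpsi.
- by move=> n w; rewrite lee_fin oppr_ge0 psi_le0.
- by move=> w; rewrite lee_fin oppr_ge0 psi_le0.
- apply: filterS2 tau_fin posterior_ae => w tw Zw; apply: cvg_near_cst.
  set t := fine (tau w); have t0 : (0 <= t)%R by exact: ftau0.
  have tE : tau w = t%:E by rewrite fineK// ge0_fin_numE.
  have [s1 [s2 [[s10 s20 sb] _]]] := path_bounds cZ w t0.
  have Zs1 : (0 < Z s1 w)%R by rewrite Zw// logistic_gt0.
  have Zs2 : (Z s2 w < 1)%R by rewrite Zw// logistic_lt1.
  have cx : x @ \oo --> (0 : R)%R.
    rewrite -[X in _ --> X](mulr0 (p / 2)%R).
    by apply: cvgM; [exact: cvg_cst|exact: cvg_harmonic].
  have cy : y @ \oo --> (1 : R)%R.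
    rewrite -[X in _ --> X]subr0 -[in X in _ --> X](mulr0 ((1 - p) / 2)%R).
    apply: cvgB; first exact: cvg_cst.
    by apply: cvgM; [exact: cvg_cst|exact: cvg_harmonic].
  apply: filterS3 (cvgr_lt _ cx _ Zs1) (cvgr_gt _ cy _ Zs2)
    (cvg_truncated (tau0 w) tw) => n xn yn tn.
  have et : (tau w <= exit_time Z (x n) (y n) w).
    rewrite leNgt; apply/negP => et; have := ltW et; rewrite tE.
    move=> /(exit_time_leP _ _ cZ w t0); apply => r /sb /andP[r1 r2].
    by rewrite (lt_le_trans xn r1) (le_lt_trans r2 yn).
  by rewrite /s /truncated /rho (min_l et) -/(truncated tau n%:R w) tn.
(* Adding the finite constant [psi l] to both sides produces the right side of [Is]; it remains that
   truncation decreases the time. *)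
- move=> n; rewrite -(leeD2lE _ _ (isT : (psi l)%:E \is a fin_num)).
  rewrite -Is addeA -EFinN -EFinD subrr add0e.
  apply: ge0_le_integral => //.
  + move=> w _; rewrite lee_fin; apply: mulr_ge0; first exact: ltW.
    by have /andP[] := s0b n w.
  + apply/measurable_EFinP; apply: measurable_funM => //; exact: ms.
  + by apply: emeasurable_funM => //; exact: measurable_cst.
  move=> w _; rewrite EFinM lee_pmul2l ?lte_fin//.
  apply: (le_trans (truncated_le (rho0 n w) (ler0n _ _))).
  by rewrite ge_min lexx.
- exact: cvg_cst.
Qed.

End finite_time.

Section exit.
Variables x y : R.
Hypotheses (x0 : (0 < x)%R) (xp : (x < p)%R) (py : (p < y)%R) (y1 : (y < 1)%R).

Let tau := exit_time Z x y.
Let s n := truncated tau n%:R.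
Let c := (`|logit x| + `|logit y|)%R.

Let Ztau : stopping_time (natural_filtration Z) tau.
Proof. exact: exit_time_stopping. Qed.

Let Gtau := posterior_stopping_time Ztau.

Let tau0 w : 0 <= tau w. Proof. exact: exit_time_ge0. Qed.

Let s0b n w : (0 <= s n w <= n%:R)%R.
Proof. exact: truncated_bounds. Qed.

Let ms n : measurable_fun [set: T] (s n).
Proof.
apply: measurable_of_le_preimage => [w|t t0]; first by have /andP[] := s0b n w.
by have [_ Gm _] := hG; apply: (Gm t t0); exact: (truncated_event hG Gtau _ t0).
Qed.

Let mtau : measurable_fun [set: T] tau.
Proof. exact: measurable_stopping_time Gtau. Qed.

Let Zs : {ae P, forall w, forall n, (x <= Z (s n w) w <= y)%R}.
Proof.
apply: filterS posterior_initial => w Z0 n; have /andP[s0 _] := s0b n w.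
apply: (inside_up_to_exit cZ); rewrite ?Z0 ?xp ?py//.
exact: truncated_le.
Qed.

Let Is n : \int[P]_w (m ^+ 2 / 2 * s n w)%:E =
  (psi l)%:E + \int[P]_w (- psi (phi (s n w) w))%:E.
Proof.
apply: (@stopped_time_identity tau n%:R x y) => //.
by apply: filterS Zs => w; exact.
Qed.

Let phic : {ae P, forall w, forall n, (`|- psi (phi (s n w) w)| <= c)%R}.
Proof.
apply: filterS2 Zs posterior_ae => w Zsw Zw n; rewrite normrN.
apply: (le_trans (psi_norm _)); apply: logistic_bound => //.
by rewrite -Zw//; have /andP[] := s0b n w.
Qed.

Let mpsi n : measurable_fun [set: T] (fun w => (- psi (phi (s n w) w))%:E).
Proof.
apply/measurable_EFinP; apply: measurableT_comp => //.
apply: (measurableT_comp measurable_psi).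
by apply: (measurable_stopped cphi mphi) => // w; have /andP[] := s0b n w.
Qed.

Let mms n : measurable_fun [set: T] (fun w => (m ^+ 2 / 2 * s n w)%:E).
Proof. by apply/measurable_EFinP; exact: measurable_funM. Qed.

Let mmtau : measurable_fun [set: T] (fun w => (m ^+ 2 / 2)%:E * tau w).
Proof. by apply: emeasurable_funM => //; exact: measurable_cst. Qed.

Let ms_ge0 n w : 0 <= (m ^+ 2 / 2 * s n w)%:E.
Proof. by rewrite lee_fin mulr_ge0 ?(ltW m2)//; have /andP[] := s0b n w. Qed.

Let mtau_ge0 w : 0 <= (m ^+ 2 / 2)%:E * tau w.
Proof. by rewrite mule_ge0// lee_fin ltW. Qed.

(** The case [tau w = +oo] is included, because the finiteness of [tau] is deduced from this
    limit. *)
Let cvg_ms w : (m ^+ 2 / 2 * s n w)%:E @[n --> \oo] --> (m ^+ 2 / 2)%:E * tau w.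
Proof.
under eq_fun do rewrite EFinM.
apply: cvgeZl => //; have := tau0 w; rewrite le_eqVlt.
have [tw _|] := ltP (tau w) +oo.
  apply: cvg_near_cst; apply: filterS (cvg_truncated (tau0 w) tw) => n.
  by rewrite /s => ->; rewrite fineK// ge0_fin_numE.
rewrite leye_eq => /eqP tw _; rewrite tw.
have -> : (fun n => (s n w)%:E) = (fun n => n%:R%:E).
  by apply/funext => n; rewrite truncatedE// tw min_r ?leey.
by apply/cvgenyP.
Qed.

(** Up to the exit [- psi] is at most [c], so [Is] bounds the mean of [s n] uniformly in [n] and
    [tau] has finite mean. *)
Lemma exit_time_finite : {ae P, forall w, tau w < +oo}.
Proof.
have Ile : \int[P]_w ((m ^+ 2 / 2)%:E * tau w) <= (psi l)%:E + c%:E.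
  apply: (@fatou_limit _ _ _ P (fun n w => (m ^+ 2 / 2 * s n w)%:E) _
    (fun=> (psi l)%:E + c%:E)) => //.
  - exact: aeW.
  - move=> n; rewrite Is leeD2l//.
    rewrite -(integral_probability_cst P c%:E).
    apply: ae_ge0_le_integral => //.
    + by move=> w _; rewrite lee_fin oppr_ge0 psi_le0.
    + by move=> w _; rewrite lee_fin /c addr_ge0.
    + by apply: filterS phic => w /(_ n) pc _; rewrite lee_fin (le_trans (ler_norm _)).
  - exact: cvg_cst.
have iT : P.-integrable setT (fun w => (m ^+ 2 / 2)%:E * tau w).
  apply/integrableP; split => //; under eq_integral do rewrite gee0_abs//.
  by apply: le_lt_trans Ile _; rewrite -EFinD ltry.
apply: filterS (integrable_ae measurableT iT) => w /(_ I) fin.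
by rewrite ltey; apply: contraTneq fin => ->; rewrite gt0_muley ?lte_fin.
Qed.

Lemma exit_time_boundary : {ae P, forall w, stopped Z tau w = x \/ stopped Z tau w = y}.
Proof.
apply: filterS2 exit_time_finite posterior_initial => w tw Z0.
have tE : tau w = (fine (tau w))%:E by rewrite fineK// ge0_fin_numE.
have := outside_at_exit cZ tE.
have /andP[] : (x <= Z (fine (tau w)) w <= y)%R.
  by apply: (inside_up_to_exit cZ); rewrite ?Z0 ?xp ?py ?fine_ge0 -?tE.
rewrite /stopped !le_eqVlt => /predU1P[->|xZ]; first by left.
by move=> /predU1P[->|Zy]; [right|rewrite xZ Zy].
Qed.

(** The reverse of [neg_psi_stopped_posterior]. Here [- psi] is bounded up to the exit, so its
    integral converges by domination and Fatou's lemma is applied to the time instead. *)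
Lemma exit_time_cost : \int[P]_w ((m ^+ 2 / 2)%:E * tau w) <=
  (psi l)%:E + \int[P]_w (- psi (phi (fine (tau w)) w))%:E.
Proof.
have mftau : measurable_fun [set: T] (fun w => fine (tau w)).
  exact: measurableT_comp.
have mpsit : measurable_fun [set: T] (fun w => (- psi (phi (fine (tau w)) w))%:E).
  apply/measurable_EFinP; apply: measurableT_comp => //.
  apply: (measurableT_comp measurable_psi).
  by apply: (measurable_stopped cphi mphi) => // w; exact: fine_ge0.
have cv : {ae P, forall w, setT w -> (- psi (phi (s n w) w))%:E @[n --> \oo] -->
    (- psi (phi (fine (tau w)) w))%:E}.
  apply: filterS exit_time_finite => w tw _; apply: cvg_near_cst.
  by apply: filterS (cvg_truncated (tau0 w) tw) => n; rewrite /s => ->.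
have dom : {ae P, forall w, forall n, setT w ->
    `|(- psi (phi (s n w) w))%:E| <= (EFin \o cst c) w}.
  by apply: filterS phic => w pc n _; rewrite /= lee_fin.
have [ipsi _ Ipsi] := dominated_convergence measurableT mpsi mpsit cv
    (finite_measure_integrable_cst _ _ measurableT) dom.
apply: (@fatou_limit _ _ _ P (fun n w => (m ^+ 2 / 2 * s n w)%:E) _
  (fun n => \int[P]_w (m ^+ 2 / 2 * s n w)%:E)) => //; first exact: aeW.
under eq_fun do rewrite Is.
by apply: cvgeD => //; exact: cvg_cst.
Qed.

End exit.

End posterior_stopping.

(** * Costs and the convex envelope *)

Section psi_unit_interval.
Context {R : realType}.

(* At the endpoints the junk values [0^-1 = 0] and [ln 0 = 0] give [Psi = 0]. *)
Lemma Psi_le0 (x : R) : 0 <= x <= 1 -> Psi x <= 0.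
Proof.
move=> /andP[x0 x1]; have [->|nx0] := eqVneq x 0.
  by rewrite /Psi mul0r ln0// mulr0.
have [->|nx1] := eqVneq x 1.
  by rewrite /Psi subrr invr0 mulr0 ln0// mulr0.
rewrite -(@logistic_logit _ x) ?Psi_logistic ?psi_le0//.
by rewrite lt_neqAle eq_sym nx0 x0 lt_neqAle nx1.
Qed.

(** The endpoints, where continuity is not assumed, are two single points and do not affect
    measurability. *)
Lemma measurable_fun_closed01 (h : R -> R) :
  (forall x : R, 0 < x < 1 -> {for x, continuous h}) -> measurable_fun [set` `[0 : R, 1]] h.
Proof.
move=> ch; apply: (@measurable_fun_itv_cc _ 0 1 false true) => //.
apply: open_continuous_measurable_fun; first exact: interval_open.
by move=> x; rewrite inE /= in_itv/=; exact: ch.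
Qed.

Lemma continuous_Psi (x : R) : 0 < x < 1 -> {for x, continuous (@Psi R)}.
Proof.
move=> /andP[x0 x1]; apply: cvgM.
  apply: cvgB; first exact: cvg_cst.
  by apply: cvgM; [exact: cvg_cst|exact: cvg_id].
apply: (@cvg_comp _ _ _ (fun x : R => x / (1 - x)) (@ln R) _
  (nbhs (x / (1 - x)))); last first.
  by apply: continuous_ln; rewrite divr_gt0// subr_gt0.
apply: cvgM; first exact: cvg_id.
apply: cvgV; first by rewrite subr_eq0 gt_eqF.
by apply: cvgB; [exact: cvg_cst|exact: cvg_id].
Qed.

End psi_unit_interval.

Section stopping_costs.
Local Open Scope ereal_scope.
Context {R : realType} {d : measure_display} {T : measurableType d}.
Variables (P : probability T R) (F : R -> set (set T)) (W : R -> T -> R).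
Variables (theta : T -> R) (Z : R -> T -> R) (alpha sigma p c : R) (g : R -> R).
Hypotheses (alpha0 : alpha != 0%R) (sigma0 : (0 < sigma)%R) (p01 : (0 < p < 1)%R).
Hypothesis c0 : (0 < c)%R.
Hypothesis model : signal_model alpha sigma p P F W theta Z.
Hypothesis mg : measurable_fun [set` `[0%R : R, 1%R]] g.
Hypothesis g_ge0 : forall x, (0 <= x <= 1)%R -> (0 <= g x)%R.

Local Notation m := (alpha / sigma)%R.
Local Notation l := (ln (p / (1 - p)))%R.
Local Notation phi := (log_odds W theta l m).
Local Notation K := (Kconst alpha sigma c).
Local Notation k := (2 * K^-1)%R.
Local Notation H := (Hfun K g).
Local Notation times := (finite_stopping_times P (natural_filtration Z)).

Let K_gt0 : (0 < K)%R.
Proof. by rewrite divr_gt0// ?exprn_even_gt0// mulr_gt0// exprn_gt0. Qed.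

Let k_ge0 : (0 <= k)%R.
Proof. by rewrite mulr_ge0// invr_ge0 ltW. Qed.

Let kE : (k * (m ^+ 2 / 2) = c)%R.
Proof. by rewrite /Kconst; field; rewrite alpha0 !gt_eqF. Qed.

Lemma Hfun_ge0 x : (0 <= x <= 1)%R -> (0 <= H x)%R.
Proof.
by move=> x01; rewrite subr_ge0 (le_trans _ (g_ge0 x01))// mulr_ge0_le0// Psi_le0.
Qed.

Lemma measurable_Hfun : measurable_fun [set` `[0%R : R, 1%R]] H.
Proof.
apply: measurable_funB => //; apply: measurable_funM => //.
by apply: measurable_fun_closed01 => x; exact: continuous_Psi.
Qed.

Section at_time.
Variable tau : T -> \bar R.
Hypothesis Ztau : stopping_time (natural_filtration Z) tau.

Lemma stopped_posterior_ge0_le1 w : (0 <= stopped Z tau w <= 1)%R.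
Proof.
have [tau0 _] := Ztau; apply: (posterior_ge0_le1 model); exact: fine_ge0.
Qed.

Lemma measurable_stopped_comp (h : R -> R) : measurable_fun [set` `[0%R : R, 1%R]] h ->
  measurable_fun [set: T] (fun w => h (stopped Z tau w)).
Proof.
move=> mh; apply: (measurable_comp _ _ mh) => //.
  by move=> _ [w _ <-] /=; rewrite in_itv/= stopped_posterior_ge0_le1.
exact: (measurable_stopped_posterior alpha0 sigma0 model Ztau).
Qed.

End at_time.

Lemma affine_mean_stopped tau (a b : R) : times tau ->
  \int[P]_w (a + b * stopped Z tau w)%:E = (a + b * p)%:E.
Proof.
move=> [Ztau tau_fin].
have mZ := measurable_stopped_posterior alpha0 sigma0 model Ztau.
have iZ : P.-integrable setT (EFin \o stopped Z tau).
  apply: measurable_bounded_integrable => //.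
    by rewrite (le_lt_trans (probability_le1 _ _)) ?ltry.
  exists 1%R; split; first exact: num_real.
  move=> z z1 w _ /=; have /andP[w0 w1] := stopped_posterior_ge0_le1 Ztau w.
  by rewrite ger0_norm// (le_trans w1)// ltW.
under eq_integral do rewrite EFinD EFinM.
rewrite integralD//; last 2 first.
- exact: finite_measure_integrable_cst.
- exact: integrableZl.
rewrite integralZl// integral_probability_cst.
by rewrite (mean_stopped_posterior alpha0 sigma0 p01 model Ztau tau_fin).
Qed.

Let measurable_neg_psi tau : stopping_time (natural_filtration Z) tau ->
  measurable_fun [set: T] (fun w => - psi (phi (fine (tau w)) w))%R.
Proof.
move=> Ztau; have [tau0 _] := Ztau.
have Gtau := posterior_stopping_time alpha0 sigma0 model Ztau.
have mtau := measurable_stopping_time (filtration_log_odds model) Gtau.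
apply: measurableT_comp => //; apply: (measurableT_comp measurable_psi).
apply: (@measurable_stopped _ _ _ phi (fun w => fine (tau w))).
- exact: (@continuous_log_odds _ _ _ _ _ _ _ _ _ _ p model).
- exact: (measurable_log_odds l m (model_filtration model) (model_brownian model)
    (model_theta_measurable model)).
- exact: measurableT_comp.
- by move=> w; exact: fine_ge0.
Qed.

Let Psi_p : Psi p = psi l.
Proof. by rewrite -Psi_logistic logistic_logit. Qed.

(** [H] is split into two nonnegative terms, so additivity holds even when the second integral is
    infinite. *)
Lemma integral_Hfun_stopped tau : times tau ->
  \int[P]_w (H (stopped Z tau w))%:E =
  \int[P]_w (g (stopped Z tau w))%:E +
  k%:E * \int[P]_w (- psi (phi (fine (tau w)) w))%:E.
Proof.
move=> [Ztau tau_fin].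
have mpsi := measurable_neg_psi Ztau.
have mgZ := measurable_stopped_comp Ztau mg.
rewrite (@ae_eq_integral _ _ _ P setT
  (fun w => (g (stopped Z tau w))%:E + k%:E * (- psi (phi (fine (tau w)) w))%:E))//.
- rewrite ge0_integralD//.
  + rewrite ge0_integralZl//; first exact/measurable_EFinP.
    by move=> w _; rewrite lee_fin oppr_ge0 psi_le0.
  + by move=> w _; rewrite lee_fin g_ge0// (stopped_posterior_ge0_le1 Ztau).
  + exact/measurable_EFinP.
  + by move=> w _; rewrite -EFinM lee_fin mulr_ge0// oppr_ge0 psi_le0.
  + by apply/measurable_EFinP; exact: measurable_funM.
- by apply/measurable_EFinP; apply: (measurable_stopped_comp Ztau); exact: measurable_Hfun.
- by apply/measurable_EFinP; apply: measurable_funD => //; exact: measurable_funM.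
- apply: filterS (stopped_posterior_ae alpha0 sigma0 p01 model Ztau) => w Zw _.
  by rewrite /Hfun Zw Psi_logistic -EFinM -EFinD mulrN.
Qed.

Lemma stopping_cost_split tau : times tau ->
  \int[P]_w (c%:E * tau w + (g (stopped Z tau w))%:E) =
  \int[P]_w (g (stopped Z tau w))%:E + k%:E * \int[P]_w ((m ^+ 2 / 2)%:E * tau w).
Proof.
move=> [Ztau tau_fin]; have [tau0 _] := Ztau.
have Gtau := posterior_stopping_time alpha0 sigma0 model Ztau.
have mtau := measurable_stopping_time (filtration_log_odds model) Gtau.
have mgZ := measurable_stopped_comp Ztau mg.
have m2 : (0 <= m ^+ 2 / 2)%R by rewrite divr_ge0// sqr_ge0.
have mct a : measurable_fun setT (fun w => a%:E * tau w).
  by apply: emeasurable_funM => //; exact: measurable_cst.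
rewrite ge0_integralD//.
- rewrite addeC; congr (_ + _); rewrite -ge0_integralZl//.
  + by apply: eq_integral => w _; rewrite muleA -EFinM kE.
  + by move=> w _; rewrite mule_ge0.
- by move=> w _; rewrite mule_ge0// lee_fin ltW.
- by move=> w _; rewrite lee_fin g_ge0// (stopped_posterior_ge0_le1 Ztau).
- exact/measurable_EFinP.
Qed.

Lemma stopping_cost_ge tau : times tau ->
  (k * Psi p)%:E + \int[P]_w (H (stopped Z tau w))%:E <=
  \int[P]_w (c%:E * tau w + (g (stopped Z tau w))%:E).
Proof.
move=> times_tau; have [Ztau tau_fin] := times_tau; have [tau0 _] := Ztau.
rewrite integral_Hfun_stopped// stopping_cost_split// addeCA leeD2l//.
have := neg_psi_stopped_posterior alpha0 sigma0 p01 model Ztau tau_fin.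
move=> /(@lee_wpmul2l _ k%:E); rewrite lee_fin => /(_ k_ge0).
(* Distributing over a possibly infinite sum uses that both summands are nonnegative; for [- psi l]
   this is [psi_le0]. *)
rewrite [leRHS]ge0_muleDr; last 2 first.
- by rewrite -EFinN lee_fin oppr_ge0 psi_le0.
- by apply: integral_ge0 => w _; rewrite mule_ge0// lee_fin divr_ge0// sqr_ge0.
move=> /(leeD2l (k * Psi p)%:E) /le_trans; apply.
by rewrite addeA Psi_p -EFinN -EFinM -EFinD mulrN subrr add0e.
Qed.

Lemma affine_minorant_le tau (a b : R) : times tau ->
  (forall x, (0 < x < 1)%R -> (a + b * x <= H x)%R) ->
  (a + b * p)%:E <= \int[P]_w (H (stopped Z tau w))%:E.
Proof.
move=> times_tau abH; have [Ztau tau_fin] := times_tau.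
(* Adding [M] makes the affine function nonnegative on [[0, 1]], so the integrals can be compared
   even if [H] of the stopped posterior is not integrable. *)
pose M := (`|a| + `|b|)%R.
have M0 : (0 <= M)%R by rewrite addr_ge0.
have mHZ := measurable_stopped_comp Ztau measurable_Hfun.
have mZ := measurable_stopped_posterior alpha0 sigma0 model Ztau.
have H0 w : (0 <= H (stopped Z tau w))%R.
  by rewrite Hfun_ge0// (stopped_posterior_ge0_le1 Ztau).
rewrite -(@leeD2rE _ M%:E)// -EFinD -[X in _ <= _ + X](integral_probability_cst P).
rewrite -ge0_integralD//; last 2 first.
- by move=> w _; rewrite lee_fin.
- exact/measurable_EFinP.
rewrite addrAC -(affine_mean_stopped (a + M) b times_tau); apply: ae_ge0_le_integral => //.
- move=> w _; have /andP[w0 w1] := stopped_posterior_ge0_le1 Ztau w.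
  rewrite lee_fin /M; have := ler_norm (- a)%R; rewrite normrN.
  have : (- `|b| <= b * stopped Z tau w)%R.
    have := ler_norm (- (b * stopped Z tau w))%R; rewrite normrN normrM (ger0_norm w0).
    have : (`|b| * stopped Z tau w <= `|b|)%R by rewrite ler_piMr.
    lra.
  lra.
- by apply/measurable_EFinP; apply: measurable_funD => //; exact: measurable_funM.
- by move=> w _; rewrite -EFinD lee_fin addr_ge0.
- by apply/measurable_EFinP; exact: measurable_funD.
- apply: filterS (stopped_posterior_ae alpha0 sigma0 p01 model Ztau) => w Zw _.
  rewrite -EFinD lee_fin addrAC lerD2r abH// Zw logistic_gt0 logistic_lt1//.
Qed.

Definition chord (h : R -> R) (x y z : R) : R :=
  (h x + (h y - h x) / (y - x) * (z - x))%R.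

(** No hitting probability is computed: at the two possible exit points [H] coincides with its
    chord, and an affine function of the stopped posterior has its value at [p] as mean. *)
Lemma exit_cost_le (x y : R) : (0 < x)%R -> (x < p)%R -> (p < y)%R -> (y < 1)%R ->
  exists2 tau, times tau &
   (\int[P]_w (c%:E * tau w + (g (stopped Z tau w))%:E) <=
      (k * Psi p + chord H x y p)%:E) /\
   (\int[P]_w (H (stopped Z tau w))%:E = (chord H x y p)%:E).
Proof.
move=> x0 xp py y1; pose tau := exit_time Z x y.
have cZ : continuous_paths Z by have [] := model_posterior model.
have times_tau : times tau.
  split; first exact: exit_time_stopping.
  exact: (exit_time_finite alpha0 sigma0 p01 model x0 xp py y1).
have [Ztau tau_fin] := times_tau; have [tau0 _] := Ztau.
have IH : \int[P]_w (H (stopped Z tau w))%:E = (chord H x y p)%:E.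
  pose b := ((H y - H x) / (y - x))%R; pose a := (H x - b * x)%R.
  rewrite /chord -/b (_ : (H x + b * (p - x) = a + b * p)%R); last by rewrite /a; ring.
  rewrite -(affine_mean_stopped a b times_tau); apply: ae_eq_integral => //.
  - by apply/measurable_EFinP; apply: (measurable_stopped_comp Ztau); exact: measurable_Hfun.
  - apply/measurable_EFinP; apply: measurable_funD => //; apply: measurable_funM => //.
    exact: (measurable_stopped_posterior alpha0 sigma0 model Ztau).
  have yx : (y - x != 0)%R by rewrite subr_eq0 gt_eqF// (lt_trans xp).
  apply: filterS (exit_time_boundary alpha0 sigma0 p01 model x0 xp py y1) => w.
  by move=> [] -> _; congr EFin; rewrite /a /b; field.
exists tau => //; split => //.
rewrite stopping_cost_split// EFinD -IH integral_Hfun_stopped// addeCA leeD2l//.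
have := exit_time_cost alpha0 sigma0 p01 model x0 xp py y1.
move=> /(@lee_wpmul2l _ k%:E); rewrite lee_fin => /(_ k_ge0) /le_trans; apply.
by rewrite muleDr ?fin_num_adde_defr// -EFinM Psi_p.
Qed.

(** Stopping at once realises the degenerate chord with both ends at [p]. *)
Lemma immediate_cost : exists2 tau, times tau &
   (\int[P]_w (c%:E * tau w + (g (stopped Z tau w))%:E) = (g p)%:E) /\
   (\int[P]_w (H (stopped Z tau w))%:E = (H p)%:E).
Proof.
pose tau (w : T) : \bar R := 0.
have times_tau : times tau.
  split; last by apply: aeW => w; exact: ltry.
  split; first by move=> w; exact: lexx.
  move=> t t0; rewrite (_ : [set w | _] = setT); first exact: sigma_processT.
  by apply/seteqP; split => // w _; rewrite /= lee_fin.
have [Ztau tau_fin] := times_tau.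
have I0 h : measurable_fun [set` `[0%R : R, 1%R]] h ->
    \int[P]_w (h (stopped Z tau w))%:E = (h p)%:E.
  move=> mh; rewrite -[RHS](integral_probability_cst P); apply: ae_eq_integral => //.
    by apply/measurable_EFinP; exact: (measurable_stopped_comp Ztau).
  by apply: filterS (posterior_initial alpha0 sigma0 p01 model) => w Zw _;
    rewrite /stopped /= Zw.
exists tau => //; split; last by apply: I0; exact: measurable_Hfun.
by under eq_integral do rewrite mule0 add0e; exact: I0.
Qed.

End stopping_costs.

(** * Two-point description of the convex envelope *)

Section envelope.
Context {R : realType}.
Variable H : R -> R.
Hypothesis H_ge0 : forall x, 0 < x < 1 -> 0 <= H x.

Definition chord_values (p : R) : set R := [set v | v = H p \/
  exists x y : R, [/\ 0 < x, x < p, p < y, y < 1 & v = chord H x y p]].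

Definition two_point_envelope (p : R) : R := inf (chord_values p).

Let f := two_point_envelope.

(** Free of division, so that chords can be compared by linear arithmetic. *)
Lemma chordE (x y z : R) : x < y ->
  (y - x) * chord H x y z = (y - z) * H x + (z - x) * H y.
Proof. by move=> xy; rewrite /chord; field; rewrite subr_eq0 gt_eqF. Qed.

Let chord_values_lb p : 0 < p < 1 -> lbound (chord_values p) 0.
Proof.
move=> p01 v [->|[x [y [x0 xp py y1 ->]]]]; first exact: H_ge0.
have xy := lt_trans xp py.
rewrite -(@pmulr_rge0 _ (y - x)) ?subr_gt0// chordE//.
by rewrite addr_ge0// mulr_ge0 ?subr_ge0 ?(ltW py) ?(ltW xp)// H_ge0//;
  apply/andP; split; lra.
Qed.

Let chord_values0 p : chord_values p !=set0.
Proof. by exists (H p); left. Qed.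

Let f_le p v : 0 < p < 1 -> chord_values p v -> f p <= v.
Proof. by move=> p01; apply: ge_inf; exists 0; exact: chord_values_lb. Qed.

Lemma two_point_envelope_le p : 0 < p < 1 -> f p <= H p.
Proof. by move=> p01; apply: f_le => //; left. Qed.

(** The bound [e] is extended because it will be a value function not yet known to be finite. *)
Lemma le_two_point_envelope p (e : \bar R) : 0 < p < 1 ->
  (forall v, chord_values p v -> (e <= v%:E)%E) -> (e <= (f p)%:E)%E.
Proof.
move=> p01 eS; rewrite -ereal_inf_EFin//; last by exists 0; exact: chord_values_lb.
by apply/ereal_infP => _ [v Sv <-]; exact: eS.
Qed.

Lemma affine_minorant_le_two_point (a b p : R) : 0 < p < 1 ->
  (forall x, 0 < x < 1 -> a + b * x <= H x) -> a + b * p <= f p.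
Proof.
move=> p01 abH; apply: lb_le_inf => // v [->|[x [y [x0 xp py y1 ->]]]]; first exact: abH.
have /andP[p0 p1] := p01; have xy := lt_trans xp py.
rewrite -(@ler_pM2l _ (y - x)) ?subr_gt0// chordE//.
have hx : (y - p) * (a + b * x) <= (y - p) * H x.
  by rewrite ler_pM2l ?subr_gt0// abH//; apply/andP; split; lra.
have hy : (p - x) * (a + b * y) <= (p - x) * H y.
  by rewrite ler_pM2l ?subr_gt0// abH//; apply/andP; split; lra.
lra.
Qed.

(* Every slope from the left of [p] is at most every slope to the right, since
   otherwise some chord would pass below the infimum. *)
Lemma two_point_envelope_support p : 0 < p < 1 ->
  exists b, forall x, 0 < x < 1 -> f p + b * (x - p) <= H x.
Proof.
move=> p01; have /andP[p0 p1] := p01.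
pose S := [set (f p - H x) / (p - x) | x in [set x | 0 < x < p]].
have S0 : S !=set0.
  exists ((f p - H (p / 2)) / (p - p / 2)); exists (p / 2) => //=.
  by apply/andP; split; lra.
have ubS y : p < y < 1 -> ubound S ((H y - f p) / (y - p)).
  move=> /andP[py y1] _ [x /= /andP[x0 xp] <-].
  have xy := lt_trans xp py.
  rewrite ler_pdivrMr ?subr_gt0// mulrAC ler_pdivlMr ?subr_gt0//.
  have : f p <= chord H x y p by apply: f_le => //; right; exists x, y.
  rewrite -(@ler_pM2l _ (y - x)) ?subr_gt0// chordE//; lra.
exists (sup S) => x /andP[x0 x1]; have [xp|px|->] := ltgtP x p.
- have : (f p - H x) / (p - x) <= sup S.
    apply: ub_le_sup; last by exists x => //=; rewrite x0.
    by exists ((H ((p + 1) / 2) - f p) / ((p + 1) / 2 - p)); apply: ubS;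
      apply/andP; split; lra.
  rewrite ler_pdivrMr ?subr_gt0//; lra.
- have : sup S <= (H x - f p) / (x - p) by apply: ge_sup => //; apply: ubS; rewrite px.
  rewrite ler_pdivlMr ?subr_gt0//; lra.
- by rewrite subrr mulr0 addr0 two_point_envelope_le.
Qed.

Lemma two_point_convex_envelope (h : R -> R) : (forall x, 0 < x < 1 -> h x = f x) ->
  convex_envelope `]0, 1[ H h.
Proof.
move=> hf; split.
- move=> t x y; rewrite !inE /= !in_itv/= => x01 y01.
  change (h (t%:num * (x : R) + (1 - t%:num) * (y : R)) <=
    t%:num * h x + (1 - t%:num) * h y).
  have : 0 <= t%:num :> R by [].
  have : t%:num <= 1 :> R by [].
  move: (t%:num : R) (x : R) (y : R) x01 y01 => {}t {}x {}y x01 y01 t1 t0.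
  set z := t * x + _.
  have z01 : 0 < z < 1.
    have /andP[x0 x1] := x01; have /andP[y0 y1] := y01.
    have [tE|tn0] := eqVneq t 0; first by rewrite /z tE; apply/andP; split; lra.
    have tx : 0 < t * x by rewrite mulr_gt0// lt_neqAle eq_sym tn0.
    have tx1 : 0 < t * (1 - x) by rewrite mulr_gt0 ?subr_gt0// lt_neqAle eq_sym tn0.
    have ty : 0 <= (1 - t) * y by rewrite mulr_ge0 ?subr_ge0// ltW.
    have ty1 : 0 <= (1 - t) * (1 - y) by rewrite mulr_ge0 ?subr_ge0// ltW.
    by rewrite /z; apply/andP; split; lra.
  (* The supporting line at [z] lies below [H], hence below [f], and meets [f] at [z]; averaging its
     values at [x] and [y] gives convexity. *)
  have [b fb] := two_point_envelope_support z01.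
  have sup_le w : 0 < w < 1 -> (f z - b * z) + b * w <= f w.
    move=> w01; apply: affine_minorant_le_two_point => // v v01.
    by have := fb v v01; lra.
  rewrite !hf//.
  have hx : t * ((f z - b * z) + b * x) <= t * f x by rewrite ler_wpM2l// sup_le.
  have hy : (1 - t) * ((f z - b * z) + b * y) <= (1 - t) * f y.
    by rewrite ler_wpM2l ?subr_ge0// sup_le.
  have zE : b * z = b * (t * x) + b * ((1 - t) * y) by rewrite /z mulrDr.
  lra.
- by move=> x /=; rewrite in_itv/= => x01; rewrite hf// two_point_envelope_le.
move=> k ck kH x /=; rewrite in_itv/= => x01; rewrite hf//.
apply: lb_le_inf => // v [->|[y [z [y0 yx xz z1 ->]]]].
  by apply: kH; rewrite /= in_itv.
have yz := lt_trans yx xz.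
have zy0 : 0 < z - y by rewrite subr_gt0.
(* The weight of [y] in [x] as a convex combination of [y] and [z]: a convex [k] below [H] lies
   below each of its own chords, hence below those of [H]. *)
have s0 : 0 <= (z - x) / (z - y) by rewrite divr_ge0 ?subr_ge0 ?ltW.
have s1 : (z - x) / (z - y) <= 1 by rewrite ler_pdivrMr// mul1r; lra.
have yD : [set` `]0 : R, 1[] y by rewrite /= in_itv/= y0 (lt_trans yz).
have zD : [set` `]0 : R, 1[] z by rewrite /= in_itv/= z1 (lt_trans y0).
have := ck (Itv01 s0 s1) y z (mem_set yD) (mem_set zD).
move=> ckx; have {ckx} : k ((z - x) / (z - y) * y + (1 - (z - x) / (z - y)) * z) <=
  (z - x) / (z - y) * k y + (1 - (z - x) / (z - y)) * k z by exact: ckx.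
rewrite (_ : _ * y + _ * z = x); last by field; rewrite gt_eqF.
rewrite -(ler_pM2l zy0) => ckx; rewrite -(ler_pM2l zy0) chordE//; move: ckx.
have -> : (z - y) * ((z - x) / (z - y) * k y + (1 - (z - x) / (z - y)) * k z) =
  (z - x) * k y + (x - y) * k z by field; rewrite gt_eqF.
move=> /le_trans; apply; apply: lerD; rewrite ler_pM2l ?subr_gt0//; exact: kH.
Qed.

End envelope.

Theorem theorem3p3 (R : realType) (alpha sigma c : R) (g : R -> R)
    (d : R -> measure_display) (Omega : forall p : R, measurableType (d p))
    (P : forall p : R, probability (Omega p) R)
    (F : forall p : R, R -> set (set (Omega p)))
    (W : forall p : R, R -> Omega p -> R)
    (theta : forall p : R, Omega p -> R)
    (Pi : forall p : R, R -> Omega p -> R)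
    (alpha0 : alpha != 0) (sigma0 : 0 < sigma) (c0 : 0 < c)
    (g1 : G1 g) (g2 : G2 g)
    (model : forall p : R, 0 < p < 1 ->
      signal_model alpha sigma p (P p) (F p) (W p) (theta p) (Pi p)) :
  let K := Kconst alpha sigma c in
  let H := Hfun K g in
  let V := fun p : R => Vstar (P p) c g (Pi p) in
  [/\ forall p : R, 0 < p < 1 -> V p \is a fin_num,
      convex_envelope `]0, 1[ H (fun p : R => fine (V p) - 2 * K^-1 * Psi p) &
      forall p : R, 0 < p < 1 ->
        (V p - (2 * K^-1 * Psi p)%:E)%E = pure_stopping_value (P p) H (Pi p)].

Proof.
move=> K H V; have [gC2 gcc ga gb] := g1.
have g_cont (x : R) : 0 < x < 1 -> {for x, continuous g}.
  by move=> /gC2[dg _ _]; apply/differentiable_continuous/derivable1_diffP.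
have mg : measurable_fun [set` `[0 : R, 1]] g by exact: measurable_fun_closed01.
(* A concave function lies above its chord between the zeros at 0 and 1; [x] is the combination of 1
   and 0 with weight [x]. *)
have g_ge0 (x : R) : 0 <= x <= 1 -> 0 <= g x.
  move=> /andP[x0 x1].
  have D0 : [set` `[0 : R, 1]] 0 by rewrite /= in_itv/= lexx ler01.
  have D1 : [set` `[0 : R, 1]] 1 by rewrite /= in_itv/= lexx ler01.
  have := gcc (Itv01 x0 x1) 1 0 (mem_set D1) (mem_set D0) => gx.
  have {gx} : - g (x * 1 + (1 - x) * 0) <= x * - g 1 + (1 - x) * - g 0 by exact: gx.
  by rewrite ga gb mulr1 mulr0 addr0 oppr0 !mulr0 addr0 oppr_le0.
have H_ge0 (x : R) : 0 < x < 1 -> 0 <= H x.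
  by move=> /andP[x0 x1]; apply: (Hfun_ge0 alpha0 sigma0 c0 g_ge0); rewrite !ltW.
pose f := two_point_envelope H.
have VN p : 0 < p < 1 -> V p = (2 * K^-1 * Psi p + f p)%:E /\
    pure_stopping_value (P p) H (Pi p) = (f p)%:E.
  move=> p01; have M := model p p01.
  have [b fb] := two_point_envelope_support H_ge0 p01.
  have N_ge : ((f p)%:E <= pure_stopping_value (P p) H (Pi p))%E.
    (* The supporting line at [p], with intercept [f p - b * p], is an affine minorant of [H] whose
       value at [p] is [f p]. *)
    apply/ereal_infP => _ [tau ttau <-].
    rewrite (_ : f p = (f p - b * p) + b * p); last by ring.
    apply: (affine_minorant_le alpha0 sigma0 p01 c0 M mg g_ge0 ttau) => x x01.
    rewrite (_ : _ + _ = f p + b * (x - p)); last by ring.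
    exact: fb.
  have V_ge : ((2 * K^-1 * Psi p + f p)%:E <= V p)%E.
    apply/ereal_infP => _ [tau ttau <-].
    apply: le_trans (stopping_cost_ge alpha0 sigma0 p01 c0 M mg g_ge0 ttau).
    rewrite EFinD leeD2l//; apply: le_trans N_ge _.
    by apply: ereal_inf_lbound; exists tau.
  have values v : chord_values H p v ->
      ((V p <= (2 * K^-1 * Psi p + v)%:E) /\
       (pure_stopping_value (P p) H (Pi p) <= v%:E))%E.
    move=> [->|[x [y [x0 xp py y1 ->]]]].
      have [tau ttau [Vtau Ntau]] := immediate_cost c alpha0 sigma0 p01 M mg.
      split; last by rewrite -Ntau; apply: ereal_inf_lbound; exists tau.
      rewrite (_ : 2 * K^-1 * Psi p + H p = g p); last by rewrite /H /Hfun; ring.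
      by rewrite -Vtau; apply: ereal_inf_lbound; exists tau.
    have [tau ttau [Vtau Ntau]] := exit_cost_le alpha0 sigma0 p01 c0 M mg g_ge0 x0 xp py y1.
    split; last by rewrite -Ntau; apply: ereal_inf_lbound; exists tau.
    by apply: le_trans Vtau; apply: ereal_inf_lbound; exists tau.
  split; apply/eqP; rewrite eq_le ?V_ge ?N_ge ?andbT /=.
    (* The finite term in [Psi p] moves to the left, leaving a bound to be checked on each chord
       value. *)
    rewrite EFinD -leeBlDl//; apply: le_two_point_envelope => // v /values[Vv _].
    by rewrite leeBlDl// -EFinD.
  by apply: le_two_point_envelope => // v /values[].
split.
- by move=> p /VN[-> _].
- apply: two_point_convex_envelope => // p /VN[-> _] /=; lra.
- by move=> p /VN[-> ->]; rewrite -EFinB; congr EFin; ring.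
Qed.
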